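(* Let $(M,\varphi,\xi,\eta,g)$ be a Sasaki-like almost contact complex Riemannian manifold, let $u,v,w$ be smooth functions on $M$, and let $$\overline\eta=e^w\eta,\qquad \overline\xi=e^{-w}\xi,$$ $$\overline g(x,y)=e^{2u}\cos 2v\; g(x,y)+e^{2u}\sin 2v\; g(x,\varphi y)+\left(e^{2w}-e^{2u}\cos 2v\right)\eta(x)\eta(y).$$ Then $(\varphi,\overline\xi,\overline\eta,\overline g)$ is Sasaki-like if and only if $$\mathrm{d}w\circ\varphi=0,\qquad \mathrm{d}u-\mathrm{d}v\circ\varphi=0,\qquad \mathrm{d}u\circ\varphi+\mathrm{d}v=(1-e^w)\eta .$$ In particular, in that case $\mathrm{d}u(\xi)=0$ and $\mathrm{d}v(\xi)=1-e^w$. If moreover $w=0$, then $u$ and $v$ do not depend on $\xi$ (i.e. $\mathrm{d}u(\xi)=\mathrm{d}v(\xi)=0$), so they are locally defined on the complex submanifold $N^{2n}$ with $TN=H=\ker\eta$ and complex structure $J=\varphi|_H$, and the complex-valued function $u+\sqrt{-1}\,v$ is holomorphic on $N^{2n}$.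
   Context: An almost contact complex Riemannian manifold $(M,\varphi,\xi,\eta,g)$ is a smooth $(2n+1)$-dimensional manifold $M$ with an endomorphism field $\varphi$ of $TM$, a vector field $\xi$, a 1-form $\eta$ and a pseudo-Riemannian metric $g$ of signature $(n+1,n)$ such that $\varphi\xi=0$, $\varphi^2=-\mathrm{Id}+\eta\otimes\xi$, $\eta\circ\varphi=0$, $\eta(\xi)=1$ and $g(\varphi x,\varphi y)=-g(x,y)+\eta(x)\eta(y)$. Let $\nabla$ be the Levi-Civita connection of $g$ and $F(x,y,z)=g((\nabla_x\varphi)y,z)$. The manifold (or the structure $(\varphi,\xi,\eta,g)$) is Sasaki-like if for all $X,Y,Z$ in $H=\ker\eta$ one has $F(X,Y,Z)=F(\xi,Y,Z)=F(\xi,\xi,Z)=0$ and $F(X,Y,\xi)=-g(X,Y)$. On a Sasaki-like manifold $\mathrm{d}\eta=0$, so $H$ is integrable and $M$ is locally a product $N^{2n}\times\mathbb R$ with $TN^{2n}=H$; $J=\varphi|_H$ is an integrable complex structure on $N^{2n}$. *)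

(* Defs.v *)
From mathcomp Require Import all_boot all_order all_algebra.
From mathcomp Require Import all_classical all_reals all_analysis.
From mathcomp Require Export complex.

Set Implicit Arguments.
Unset Strict Implicit.
Unset Printing Implicit Defensive.

Import Order.TTheory GRing.Theory Num.Theory.
Import numFieldNormedType.Exports.

Local Open Scope classical_set_scope.
Local Open Scope ring_scope.

(* C^oo maps between finite-dimensional normed spaces: on a finite-dimensional
   domain, being infinitely differentiable amounts to f and all its iterated
   directional derivatives being (Frechet) differentiable. *)
Fixpoint times_differentiable {R : realType} {V W : normedModType R}
    (k : nat) (A : set V) (f : V -> W) : Prop :=
  if k is k'.+1 then
    (forall a, A a -> differentiable f a) /\
    (forall v : V, times_differentiable k' A (fun a => 'D_v f a))
  else True.

Definition smooth_on {R : realType} {V W : normedModType R}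
    (A : set V) (f : V -> W) : Prop :=
  forall k, times_differentiable k A f.

(* cinv is only meaningful on the open set cmap @` cdom. *)
Record chart (R : realType) (m : nat) (M : topologicalType) := Chart {
  cdom : set M;
  cmap : M -> 'rV[R]_m;
  cinv : 'rV[R]_m -> M;
  cdom_open : open cdom;
  cimg_open : open (cmap @` cdom);
  cmap_continuous : {in cdom, continuous cmap};
  cinv_continuous : {in cmap @` cdom, continuous cinv};
  cmapK : {in cdom, cancel cmap cinv} }.

(* A preferred chart chart_at p around every point p is part of the data; it
   only serves to represent tangent vectors at p by coordinate vectors. *)
Record manifold (R : realType) (m : nat) := Manifold {
  mpoint :> topologicalType;
  atlas : set (chart R m mpoint);
  chart_at : mpoint -> chart R m mpoint;
  chart_at_atlas : forall p, atlas (chart_at p);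
  chart_at_dom : forall p, cdom (chart_at p) p;
  atlas_compatible : forall c c', atlas c -> atlas c' ->
    smooth_on (cmap c @` (cdom c `&` cdom c')) (cmap c' \o cinv c);
  manifold_hausdorff : hausdorff_space mpoint;
  manifold_second_countable : @second_countable mpoint }.

Section Manifold.
Variables (R : realType) (m : nat) (M : manifold R m).

(* Each tangent space T_p M is identified with 'rV[R]_m: a vector x of T_p M is
   given by its coordinates in the chart chart_at p, and its coordinates in a
   chart c around p are tcoord c p x.  Every tensor below acts on T_p M through
   this identification; its smoothness is tested on smooth local vector fields. *)
Definition coord0 (p : M) : 'rV[R]_m := cmap (chart_at p) p.

Definition tcoord (c : chart R m M) (p : M) (x : 'rV[R]_m) : 'rV[R]_m :=
  'd (cmap c \o cinv (chart_at p)) (coord0 p) x.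

Definition smooth_function (A : set M) (f : M -> R) : Prop :=
  forall c, atlas c ->
    smooth_on (cmap c @` (A `&` cdom c)) (f \o cinv c : _ -> R^o).

Definition dfun (f : M -> R) (p : M) (x : 'rV[R]_m) : R :=
  'd (f \o cinv (chart_at p) : _ -> R^o) (coord0 p) x.

Definition vector_field := M -> 'rV[R]_m.

Definition smooth_field (A : set M) (X : vector_field) : Prop :=
  forall c, atlas c ->
    smooth_on (cmap c @` (A `&` cdom c))
      (fun y => tcoord c (cinv c y) (X (cinv c y))).

Definition one_form (eta : M -> 'rV[R]_m -> R) : Prop :=
  (forall p a x y, eta p (a *: x + y) = a * eta p x + eta p y) /\
  (forall A X, open A -> smooth_field A X ->
    smooth_function A (fun p => eta p (X p))).

Definition endomorphism_field (phi : M -> 'rV[R]_m -> 'rV[R]_m) : Prop :=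
  (forall p a x y, phi p (a *: x + y) = a *: phi p x + phi p y) /\
  (forall A X, open A -> smooth_field A X ->
    smooth_field A (fun p => phi p (X p))).

Definition has_signature (s t : nat) (b : 'rV[R]_m -> 'rV[R]_m -> R) : Prop :=
  (s + t = m)%N /\
  exists2 B : 'M[R]_m, B \in unitmx &
    forall i j, b (row i B) (row j B) =
      (if i == j then if (i < s)%N then 1 else -1 else 0).

Record pseudo_riemannian (s t : nat) (g : M -> 'rV[R]_m -> 'rV[R]_m -> R) :
    Prop := PseudoRiemannian {
  metric_linear : forall p a x y z,
    g p (a *: x + y) z = a * g p x z + g p y z;
  metric_sym : forall p x y, g p x y = g p y x;
  metric_smooth : forall A X Y, open A -> smooth_field A X ->
    smooth_field A Y -> smooth_function A (fun p => g p (X p) (Y p));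
  metric_signature : forall p, has_signature s t (g p) }.

(* Affine connections, acting on local vector fields: the axioms hold on every
   open set A for sections whose restrictions to A are smooth. *)
Record connection (nabla : vector_field -> vector_field -> vector_field) :
    Prop := Connection {
  connection_smooth : forall A X Y, open A ->
    smooth_field A X -> smooth_field A Y -> smooth_field A (nabla X Y);
  connectionDl : forall A X X' Y p, open A -> A p -> smooth_field A X ->
    smooth_field A X' -> smooth_field A Y ->
    nabla (fun q => X q + X' q) Y p = nabla X Y p + nabla X' Y p;
  connectionZl : forall A f X Y p, open A -> A p -> smooth_function A f ->
    smooth_field A X -> smooth_field A Y ->
    nabla (fun q => f q *: X q) Y p = f p *: nabla X Y p;
  connectionDr : forall A X Y Y' p, open A -> A p -> smooth_field A X ->
    smooth_field A Y -> smooth_field A Y' ->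
    nabla X (fun q => Y q + Y' q) p = nabla X Y p + nabla X Y' p;
  connectionZr : forall A f X Y p, open A -> A p -> smooth_function A f ->
    smooth_field A X -> smooth_field A Y ->
    nabla X (fun q => f q *: Y q) p =
      dfun f p (X p) *: Y p + f p *: nabla X Y p }.

(* The bracket [X, Y] is the vector field acting on (local) functions f by
   X (Y f) - Y (X f). *)
Definition torsion_free (nabla : vector_field -> vector_field -> vector_field) :
    Prop :=
  forall A X Y f p, open A -> A p -> smooth_field A X -> smooth_field A Y ->
    smooth_function A f ->
    dfun f p (nabla X Y p - nabla Y X p) =
      dfun (fun q => dfun f q (Y q)) p (X p) -
      dfun (fun q => dfun f q (X q)) p (Y p).

Definition metric_compatible (g : M -> 'rV[R]_m -> 'rV[R]_m -> R)
    (nabla : vector_field -> vector_field -> vector_field) : Prop :=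
  forall A X Y Z p, open A -> A p ->
    smooth_field A X -> smooth_field A Y -> smooth_field A Z ->
    dfun (fun q => g q (Y q) (Z q)) p (X p) =
      g p (nabla X Y p) (Z p) + g p (Y p) (nabla X Z p).

Definition levi_civita (g : M -> 'rV[R]_m -> 'rV[R]_m -> R)
    (nabla : vector_field -> vector_field -> vector_field) : Prop :=
  [/\ connection nabla, torsion_free nabla & metric_compatible g nabla].

(* F(X, Y, Z) = g((nabla_X phi) Y, Z) *)
Definition Ftensor (phi : M -> 'rV[R]_m -> 'rV[R]_m)
    (g : M -> 'rV[R]_m -> 'rV[R]_m -> R)
    (nabla : vector_field -> vector_field -> vector_field)
    (X Y Z : vector_field) (p : M) : R :=
  g p (nabla X (fun q => phi q (Y q)) p - phi p (nabla X Y p)) (Z p).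

(* f is holomorphic for the (almost) complex structure J when its complex
   differential satisfies df (J x) = i df (x). *)
Definition cdfun (f : M -> R[i]) (p : M) (x : 'rV[R]_m) : R[i] :=
  Complex (dfun (fun q => complex.Re (f q)) p x)
          (dfun (fun q => complex.Im (f q)) p x).

Definition holomorphic (J : M -> 'rV[R]_m -> 'rV[R]_m) (f : M -> R[i]) : Prop :=
  [/\ smooth_function setT (fun q => complex.Re (f q)),
      smooth_function setT (fun q => complex.Im (f q)) &
      forall p x, cdfun f p (J p x) = Complex 0 1 * cdfun f p x].

End Manifold.

Section AlmostContact.
Variables (R : realType) (n : nat) (M : manifold R (2 * n).+1).
Local Notation T := 'rV[R]_(2 * n).+1.
Implicit Types (phi : M -> T -> T) (xi : M -> T) (eta : M -> T -> R).
Implicit Types (g : M -> T -> T -> R).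

Record almost_contact_complex_riemannian phi xi eta g : Prop :=
    AlmostContactComplexRiemannian {
  ac_phi : endomorphism_field phi;
  ac_xi : smooth_field setT (xi : vector_field M);
  ac_eta : one_form eta;
  ac_g : pseudo_riemannian n.+1 n g;
  ac_phi_xi : forall p, phi p (xi p) = 0;
  ac_phi_phi : forall p x, phi p (phi p x) = - x + eta p x *: xi p;
  ac_eta_phi : forall p x, eta p (phi p x) = 0;
  ac_eta_xi : forall p, eta p (xi p) = 1;
  ac_g_phi : forall p x y,
    g p (phi p x) (phi p y) = - g p x y + eta p x * eta p y }.

Definition in_H eta (A : set M) (X : vector_field M) : Prop :=
  smooth_field A X /\ forall p, A p -> eta p (X p) = 0.

(* The Levi-Civita connection exists and is unique (on smooth local fields) for
   every metric, so the existential quantifier merely names it.  The conditions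
   on F are imposed on all smooth local sections X, Y, Z of H; F being
   tensorial, this is the same as on all vectors of H. *)
Definition sasaki_like phi xi eta g : Prop :=
  almost_contact_complex_riemannian phi xi eta g /\
  exists2 nabla, levi_civita g nabla &
    forall A X Y Z p, open A -> A p ->
      in_H eta A X -> in_H eta A Y -> in_H eta A Z ->
      [/\ Ftensor phi g nabla X Y Z p = 0,
          Ftensor phi g nabla xi Y Z p = 0,
          Ftensor phi g nabla xi xi Z p = 0 &
          Ftensor phi g nabla X Y xi p = - g p (X p) (Y p)].

End AlmostContact.

Section Maps.
Variables (R : realType) (m k : nat) (N : manifold R m) (M : manifold R k).

Definition smooth_map (A : set N) (f : N -> M) : Prop :=
  (forall q, A q -> {for q, continuous f}) /\
  forall c c', atlas c -> atlas c' ->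
    smooth_on (cmap c @` (A `&` cdom c `&` f @^-1` cdom c'))
      (cmap c' \o f \o cinv c).

Definition mdiff (f : N -> M) (q : N) (y : 'rV[R]_m) : 'rV[R]_k :=
  'd (cmap (chart_at (f q)) \o f \o cinv (chart_at q)) (coord0 q) y.

Definition velocity (f : R -> M) (t : R) : 'rV[R]_k :=
  derive1 (cmap (chart_at (f t)) \o f) t.

(* Smoothness of a map N x R -> M on the open set N x I. *)
Definition smooth_family (I : set R) (Psi : N * R -> M) : Prop :=
  (forall z, I z.2 -> {for z, continuous Psi}) /\
  forall c c', atlas c -> atlas c' ->
    smooth_on
      [set z : 'rV[R]_m * R^o | [/\ (cmap c @` cdom c) z.1, I z.2 &
                                 cdom c' (Psi (cinv c z.1, z.2))]]
      (fun z => cmap c' (Psi (cinv c z.1, z.2))).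

End Maps.

(* A local decomposition of M as a product N x I: Psi is a diffeomorphism of
   N x I onto an open subset U of M, with inverse (pr, tm), such that
   T(N x {t}) = ker eta and the factor I is tangent to xi. *)
Record local_product (R : realType) (n : nat) (M : manifold R (2 * n).+1)
    (xi : M -> 'rV[R]_(2 * n).+1) (eta : M -> 'rV[R]_(2 * n).+1 -> R)
    (N : manifold R (2 * n)) (I : set R) (Psi : N * R -> M) : Prop :=
    LocalProduct {
  lp_open : open I;
  lp_interval : is_interval I;
  lp_nonempty : I !=set0;
  lp_smooth : smooth_family I Psi;
  lp_inverse : exists (U : set M) (pr : M -> N) (tm : M -> R),
    [/\ open U, smooth_map U pr, smooth_function U tm,
        forall q t, I t -> [/\ U (Psi (q, t)), pr (Psi (q, t)) = q
                             & tm (Psi (q, t)) = t] &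
        forall p, U p -> I (tm p) /\ Psi (pr p, tm p) = p];
  lp_horizontal : forall q t, I t ->
    range (mdiff (fun q' => Psi (q', t)) q) =
      [set x | eta (Psi (q, t)) x = 0];
  lp_vertical : forall q t, I t ->
    exists a : R, velocity (fun s => Psi (q, s)) t = a *: xi (Psi (q, t)) }.

(* J = phi|_H on N, where TN is identified with H along iota. *)
Definition restricts_to (R : realType) (m k : nat) (N : manifold R m)
    (M : manifold R k) (phi : M -> 'rV[R]_k -> 'rV[R]_k) (iota : N -> M)
    (J : N -> 'rV[R]_m -> 'rV[R]_m) : Prop :=
  forall q y, mdiff iota q (J q y) = phi (iota q) (mdiff iota q y).

Section Deformation.
Variables (R : realType) (m : nat) (M : manifold R m).
Implicit Types (u v w : M -> R).

Definition eta_bar w (eta : M -> 'rV[R]_m -> R) (p : M) (x : 'rV[R]_m) : R :=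
  expR (w p) * eta p x.

Definition xi_bar w (xi : M -> 'rV[R]_m) (p : M) : 'rV[R]_m :=
  expR (- w p) *: xi p.

Definition g_bar u v w (phi : M -> 'rV[R]_m -> 'rV[R]_m)
    (eta : M -> 'rV[R]_m -> R) (g : M -> 'rV[R]_m -> 'rV[R]_m -> R)
    (p : M) (x y : 'rV[R]_m) : R :=
  expR (2 * u p) * cos (2 * v p) * g p x y +
  expR (2 * u p) * sin (2 * v p) * g p x (phi p y) +
  (expR (2 * w p) - expR (2 * u p) * cos (2 * v p)) * eta p x * eta p y.

End Deformation.

(* Main.v *)
(* The Sasaki-like condition for (phi, xi, eta, g) is equivalent to
     (nabla_X phi) Y = - g(X, Y) xi - eta(Y) X + 2 eta(X) eta(Y) xi,
   which also forces nabla_X xi = - phi X.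

   Necessity.  Let D be the difference of the Levi-Civita connections of the deformed
   metric gb and of g.  It is symmetric, and comparing the two formulas for the
   derivative of phi shows that on H = ker eta, modulo xi, it is complex bilinear with
   respect to phi.  The symmetry of eta(D(x, y)) gives dw o phi = 0.  Writing gb on H as
   a g + b g(., phi .), with a + i b = exp(2 (u + i v)), the equation
     (nabla_x gb)(y, z) = gb(D(x, y), z) + gb(y, D(x, z))
   gives d(a + i b) o phi = i d(a + i b) on H, and, since D(xi, .) is explicit, the
   derivative of a + i b along xi.

   Sufficiency.  The Levi-Civita connection of gb is nabla + D, where D is on H the
   conformal change of a complex metric by the holomorphic function u + i v; it
   involves the gradient of u, whose smoothness comes from inverting Gram matrices.
   The signature of gb is that of g since gb(x, y) = g(k x, k y) on H with
   k = exp(u + i v).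

   When w = 0, u and v have vanishing derivative along the curves t |-> Psi(q, t),
   which are tangent to xi, and the equations restrict to the Cauchy-Riemann
   equations on the slices. *)

From HB Require Import structures.
Require Import Defs.
From mathcomp Require Import all_boot all_order all_algebra perm.
From mathcomp Require Import all_classical all_reals all_analysis.
From mathcomp Require Import ring lra.

Set Implicit Arguments.
Unset Strict Implicit.
Unset Printing Implicit Defensive.

Import Order.TTheory GRing.Theory Num.Theory.
Import numFieldNormedType.Exports.

Local Open Scope classical_set_scope.
Local Open Scope ring_scope.

(** * Iterated differentiability *)

Section Differentials.
Variable R : realType.

(** Chart expressions of a function agree only near a point, so differentials are compared through
    germs: [g] inherits the first-order expansion of [f], which yields both its differentiability
    and, by uniqueness, its differential. *)
Lemma near_eq_diff_expansion (V W : normedModType R) (f g : V -> W) (a : V) :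
  (\near a, f a = g a) -> differentiable f a ->
  g \o shift a = cst (g a) + 'd f a +o_ 0 id.
Proof.
move=> fg /diff_locallyP[_ fE]; apply/eqaddoP => e e0.
have /eqaddoP/(_ e e0) := fE.
have fg0 : \forall h \near (0 : V), f (h + a) = g (h + a).
  by move: fg; rewrite (near_shift 0) /=; apply: filterS => h; rewrite subr0.
have fga : f a = g a by exact: (nbhs_singleton fg).
by apply: filterS2 fg0 => h /= fgh; rewrite -fga !fctE /= fgh.
Qed.

Lemma near_eq_diff (V W : normedModType R) (f g : V -> W) (a : V) :
  (\near a, f a = g a) -> differentiable f a -> 'd g a =1 'd f a.
Proof.
move=> fg df x; congr (_ x).
by apply: diff_unique; [exact: diff_continuous | exact: near_eq_diff_expansion].
Qed.

Lemma diff_compE (U V W : normedModType R) (f : U -> V) (g : V -> W) (a x : U) :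
  differentiable f a -> differentiable g (f a) ->
  'd (g \o f) a x = 'd g (f a) ('d f a x).
Proof. by move=> df dg; rewrite (diff_comp df dg). Qed.

Lemma near_eq_differentiable (V W : normedModType R) (f g : V -> W) (a : V) :
  (\near a, f a = g a) -> differentiable f a -> differentiable g a.
Proof.
move=> fg df; apply/diff_locallyP; rewrite (funext (near_eq_diff fg df)); split.
  exact: diff_continuous.
exact: near_eq_diff_expansion.
Qed.

Lemma scale_bilinear (W : normedModType R) :
  bilinear_for
    (GRing.Scale.Law.clone _ _ *:%R _) (GRing.Scale.Law.clone _ _ *:%R _)
    (fun (a : R^o) (x : W) => a *: x).
Proof.
split=> [x|a] b y z /=; first by rewrite scalerDl scalerA.
by rewrite scalerDr !scalerA mulrC.
Qed.

(** Chain rule through the pair [(f, F)] and the continuous bilinear map [a *: x]. *)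
Lemma is_diff_scale (V W : normedModType R) (f : V -> R^o) (F : V -> W) (a : V) :
  differentiable f a -> differentiable F a ->
  is_diff a (fun x => f x *: F x)
    (fun x => f a *: 'd F a x + ('d f a x : R^o) *: F a).
Proof.
move=> df dF.
pose B : {bilinear R^o -> W -> W} := HB.pack (fun (a : R^o) (x : W) => a *: x)
  (bilinear_isBilinear.Build R R^o W W _ _ _ (@scale_bilinear W)).
have cB : continuous (fun p : R^o * W => B p.1 p.2) by move=> p; exact: scale_continuous.
have db := differentiable_bilin (f a, F a) cB.
have dp := differentiable_pair df dF.
apply: DiffDef; first exact: (differentiable_comp dp db).
have := diff_comp dp db; rewrite diff_bilin // diff_pair //= => ->.
Qed.

End Differentials.

Section TimesDifferentiable.
Variable R : realType.
Implicit Types (V W Z : normedModType R).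

Lemma open_near V (A : set V) (P : V -> Prop) a : open A -> A a ->
  (forall x, A x -> P x) -> \forall x \near a, P x.
Proof. by move=> oA Aa AP; apply: filterS AP _; exact: open_nbhs_nbhs. Qed.

Lemma times_differentiable_eq V W k (A : set V) (f g : V -> W) : open A ->
  (forall a, A a -> f a = g a) ->
  times_differentiable k A f -> times_differentiable k A g.
Proof.
move=> oA; elim: k f g => [//|k IH] f g fg /= [df Df]; split=> [a Aa|v].
  by apply: near_eq_differentiable (df a Aa); exact: open_near fg.
apply: IH (Df v) => a Aa; apply: near_eq_derive; exact: open_near fg.
Qed.

Lemma times_differentiable_sub V W k (A B : set V) (f : V -> W) : B `<=` A ->
  times_differentiable k A f -> times_differentiable k B f.
Proof.
move=> BA; elim: k f => [//|k IH] f /= [df Df]; split=> [a /BA/df//|v].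
exact/IH/Df.
Qed.

Lemma times_differentiableW V W k (A : set V) (f : V -> W) :
  times_differentiable k.+1 A f -> times_differentiable k A f.
Proof.
elim: k f => [//|k IH] f [df Df]; split=> // v; exact/IH/Df.
Qed.

Lemma times_differentiable_cst V W k (A : set V) (b : W) :
  times_differentiable k A (cst b).
Proof.
elim: k b => [//|k IH] b; split=> // v.
rewrite (_ : (fun _ => _) = cst 0) //.
by apply/funext => a; rewrite derive_cst.
Qed.

Lemma times_differentiableD V W k (A : set V) (f g : V -> W) : open A ->
  times_differentiable k A f -> times_differentiable k A g ->
  times_differentiable k A (fun x => f x + g x).
Proof.
move=> oA; elim: k f g => [//|k IH] f g /= [df Df] [dg Dg]; split=> [a Aa|v].
  exact: (differentiableD (df a Aa) (dg a Aa)).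
apply: (times_differentiable_eq oA _ (IH _ _ (Df v) (Dg v))) => a Aa.
by rewrite -deriveD //; apply: diff_derivable; [exact: df|exact: dg].
Qed.

(** By the product rule the derivative is a sum of two products, each with one differentiated
    factor; [times_differentiableW] lowers the order of the other one, so that the induction
    hypothesis applies. *)
Lemma times_differentiable_scale V W k (A : set V) (f : V -> R^o) (F : V -> W) :
  open A -> times_differentiable k A f -> times_differentiable k A F ->
  times_differentiable k A (fun x => f x *: F x).
Proof.
move=> oA; elim: k f F => [//|k IH] f F df0 dF0.
have [df Df] := df0; have [dF DF] := dF0.
have H a : A a -> is_diff a (fun x => f x *: F x) _ :=
  fun Aa => is_diff_scale (df a Aa) (dF a Aa).
split=> [a /H[]//|v].
apply: (times_differentiable_eq oA _ (times_differentiableD oA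
  (IH _ _ (times_differentiableW df0) (DF v))
  (IH _ _ (Df v) (times_differentiableW dF0)))) => a Aa.
have [d1 d2] := H a Aa.
rewrite [RHS](deriveE v d1) d2 (deriveE v (df a Aa)) (deriveE v (dF a Aa)).
reflexivity.
Qed.

Lemma times_differentiable_sum V W k n (A : set V) (f : 'I_n -> V -> W) :
  open A -> (forall i, times_differentiable k A (f i)) ->
  times_differentiable k A (fun x => \sum_i f i x).
Proof.
move=> oA; elim: n f => [|n IH] f df.
  rewrite (_ : (fun _ => _) = cst 0); first exact: times_differentiable_cst.
  by apply/funext => x; rewrite big_ord0.
rewrite (_ : (fun _ => _) = fun x => f ord0 x + \sum_i f (lift ord0 i) x).
  by apply: times_differentiableD => //; exact: IH.
by apply/funext => x; rewrite big_ord_recl.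
Qed.

Lemma times_differentiable_linear V W Z k (A : set V) (f : V -> W)
    (L : {linear W -> Z}) : open A -> continuous L ->
  times_differentiable k A f -> times_differentiable k A (L \o f).
Proof.
move=> oA cL; have dL y := linear_differentiable y cL.
elim: k f => [//|k IH] f [df Df]; split=> [a Aa|v].
  by apply: differentiable_comp (dL _); exact: df.
apply: (times_differentiable_eq oA _ (IH _ (Df v))) => a Aa /=.
have dfa := df _ Aa; have dLfa := differentiable_comp dfa (dL (f a)).
have dE : 'd (L \o f) a = L \o 'd f a :> (V -> Z).
  by rewrite (diff_comp dfa (dL _)) diff_lin.
by rewrite (deriveE _ dfa) (deriveE _ dLfa) dE.
Qed.

(* Finite-dimensionality of the intermediate space, given by a basis e with
   continuous coordinates l, makes the differential of g a finite sum of the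
   directional derivatives that the definition controls. *)
Lemma times_differentiable_comp V W Z k n (A : set V) (B : set W)
    (f : V -> W) (g : W -> Z) (l : 'I_n -> {linear W -> R^o}) (e : 'I_n -> W) :
  open A -> open B -> (forall i, continuous (l i)) ->
  (forall x, x = \sum_i l i x *: e i) -> (forall a, A a -> B (f a)) ->
  times_differentiable k A f -> times_differentiable k B g ->
  times_differentiable k A (g \o f).
Proof.
move=> oA oB cl le AB; elim: k f g AB => [//|k IH] f g AB df0 dg0.
have [df Df] := df0; have [dg Dg] := dg0.
split=> [a Aa|v].
  by apply: differentiable_comp; [exact: df|exact/dg/AB].
have T : times_differentiable k A (fun a =>
    \sum_i (l i ('D_v f a) : R^o) *: 'D_(e i) g (f a)).
  apply: times_differentiable_sum => // i; apply: times_differentiable_scale => //.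
    exact: (times_differentiable_linear (L := l i) oA (cl i) (Df v)).
  exact: (IH _ _ AB (times_differentiableW df0) (Dg (e i))).
apply: (times_differentiable_eq oA _ T) => a Aa.
have dga := dg _ (AB _ Aa); have dfa := df _ Aa.
rewrite (deriveE _ (differentiable_comp dfa dga)) (diff_comp dfa dga) /=.
rewrite -(deriveE v dfa) [in RHS](le ('D_v f a)) linear_sum.
by apply: eq_bigr => i _; rewrite linearZ (deriveE _ dga).
Qed.

Definition rV_coord n (i : 'I_n) (y : 'rV[R]_n) : R^o := y 0 i.

Lemma coord_is_linear n (i : 'I_n) : linear (rV_coord i).
Proof. by move=> a x y; rewrite /rV_coord !mxE. Qed.

HB.instance Definition _ n (i : 'I_n) :=
  GRing.isLinear.Build _ _ _ _ _ (coord_is_linear i).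

Lemma times_differentiable_comp_rV V Z k n (A : set V) (B : set 'rV[R]_n)
    (f : V -> 'rV[R]_n) (g : 'rV[R]_n -> Z) :
  open A -> open B -> (forall a, A a -> B (f a)) ->
  times_differentiable k A f -> times_differentiable k B g ->
  times_differentiable k A (g \o f).
Proof.
move=> oA oB AB.
apply: (times_differentiable_comp (l := @rV_coord n) (e := fun i => delta_mx 0 i)) => //.
  by move=> i x; exact: coord_continuous.
exact: row_sum_delta.
Qed.

Lemma times_differentiable_comp_R V Z k (A : set V) (B : set R^o)
    (f : V -> R^o) (g : R^o -> Z) :
  open A -> open B -> (forall a, A a -> B (f a)) ->
  times_differentiable k A f -> times_differentiable k B g ->
  times_differentiable k A (g \o f).
Proof.
move=> oA oB AB.
apply: (times_differentiable_comp (n := 1) (l := fun=> idfun) (e := fun=> 1)) => //.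
  by move=> _ x.
by move=> x; rewrite big_ord1 /= [LHS](esym (mulr1 x)).
Qed.

End TimesDifferentiable.

(** * Smooth maps: elementary functions, algebraic operations, inverse matrices *)

Section SmoothOn.
Variable R : realType.
Implicit Types (V W Z : normedModType R).

Lemma diff_of_is_derive (f : R^o -> R^o) (x f' : R) : is_derive x 1 f f' ->
  differentiable f x /\ forall h, 'd f x h = h * f'.
Proof.
move=> [df <-]; have dfx : differentiable f x by exact/derivable1_diffP.
by split=> // h; rewrite (diff1E dfx) derive1E.
Qed.

(** In one variable $D_v f(x) = v f'(x)$, so [f'] controls all directional derivatives. Smoothness
    of the elementary functions becomes an induction on their known derivatives. *)
Lemma times_differentiable_of_is_derive k (A : set R^o) (f f' : R^o -> R^o) :
  open A -> (forall x, A x -> is_derive (x : R) 1 f (f' x)) ->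
  times_differentiable k A f' -> times_differentiable k.+1 A f.
Proof.
move=> oA Df df'; split=> [x /Df/diff_of_is_derive[]//|v].
apply: (@times_differentiable_eq _ _ _ _ _ (fun x => f' x *: (v : R^o))) => //.
  move=> x Ax; have [dfx ->] : differentiable f x /\ 'D_v f x = v * f' x.
    by have [dfx E] := diff_of_is_derive (Df x Ax); split=> //; rewrite deriveE.
  by rewrite mulrC.
by apply: times_differentiable_scale => //; exact: times_differentiable_cst.
Qed.

Lemma smooth_expR : smooth_on setT (expR : R^o -> R^o).
Proof.
elim=> [//|k IH].
by apply: (times_differentiable_of_is_derive openT _ IH) => x _; exact: is_derive_expR.
Qed.

(** The induction is joint because each function is, up to sign, the derivative of the other. *)
Lemma times_differentiable_trig k :
  times_differentiable k setT (cos : R^o -> R^o) /\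
  times_differentiable k setT (sin : R^o -> R^o).
Proof.
elim: k => [//|k [ck sk]]; split.
  apply: (@times_differentiable_of_is_derive _ _ _ (fun x => (-1 : R^o) *: sin x)) => //.
  - exact: openT.
  - by move=> x _; rewrite /= scaleN1r; exact: is_derive_cos.
  - apply: times_differentiable_scale => //; first exact: openT.
    exact: times_differentiable_cst.
apply: (times_differentiable_of_is_derive openT _ ck) => x _.
Qed.

Lemma smooth_cos : smooth_on setT (cos : R^o -> R^o).
Proof. by move=> k; have [] := times_differentiable_trig k. Qed.

Lemma smooth_sin : smooth_on setT (sin : R^o -> R^o).
Proof. by move=> k; have [] := times_differentiable_trig k. Qed.

Lemma open_neq0 : open [set x : R^o | x != 0].
Proof. exact: open_neq. Qed.

Lemma smooth_inv : smooth_on [set x : R^o | x != 0] (GRing.inv : R^o -> R^o).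
Proof.
elim=> [//|k IH].
(* The derivative $-x^{-2}$ is written as a product of inverses, so that the induction hypothesis
   applies to each factor. *)
apply: (@times_differentiable_of_is_derive _ _ _
  (fun x => (-1 : R^o) *: (x^-1 *: x^-1 : R^o))); first exact: open_neq0.
  move=> x /= x0; have dx := differentiable_Rinv x0.
  apply: DeriveDef; first exact: diff_derivable.
  by rewrite deriveE // diff_Rinv // scaleN1r [LHS]mulr1 -exprVn.
apply: times_differentiable_scale; [exact: open_neq0|exact: times_differentiable_cst|].
by apply: times_differentiable_scale => //; exact: open_neq0.
Qed.

Variables (V : normedModType R) (A : set V).
Hypothesis oA : open A.

Lemma smooth_on_differentiable W (f : V -> W) a :
  smooth_on A f -> A a -> differentiable f a.
Proof. by move=> /(_ 1%N)[df _] /df. Qed.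

Lemma smooth_on_eq W (f g : V -> W) : (forall a, A a -> f a = g a) ->
  smooth_on A f -> smooth_on A g.
Proof. by move=> fg sf k; exact: (times_differentiable_eq oA fg (sf k)). Qed.

Lemma smooth_on_sub W (B : set V) (f : V -> W) : B `<=` A ->
  smooth_on A f -> smooth_on B f.
Proof. by move=> BA sf k; exact: (times_differentiable_sub BA (sf k)). Qed.

Lemma smooth_on_cst W (b : W) : smooth_on A (cst b).
Proof. by move=> k; exact: times_differentiable_cst. Qed.

Lemma smooth_onD W (f g : V -> W) :
  smooth_on A f -> smooth_on A g -> smooth_on A (fun x => f x + g x).
Proof. by move=> sf sg k; exact: (times_differentiableD oA (sf k) (sg k)). Qed.

Lemma smooth_on_scale W (f : V -> R^o) (F : V -> W) :
  smooth_on A f -> smooth_on A F -> smooth_on A (fun x => f x *: F x).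
Proof. by move=> sf sF k; exact: (times_differentiable_scale oA (sf k) (sF k)). Qed.

Lemma smooth_onM (f g : V -> R^o) :
  smooth_on A f -> smooth_on A g -> smooth_on A (fun x => f x * g x : R^o).
Proof. exact: smooth_on_scale. Qed.

Lemma smooth_on_sum W n (f : 'I_n -> V -> W) :
  (forall i, smooth_on A (f i)) -> smooth_on A (fun x => \sum_i f i x).
Proof. by move=> sf k; apply: times_differentiable_sum => // i; exact: (sf i k). Qed.

Lemma smooth_on_derive W (f : V -> W) v :
  smooth_on A f -> smooth_on A (fun x => 'D_v f x).
Proof. by move=> sf k; have [_ Df] := sf k.+1; exact: Df. Qed.

Lemma smooth_on_comp_rV Z n (B : set 'rV[R]_n) (f : V -> 'rV[R]_n)
    (g : 'rV[R]_n -> Z) : open B -> (forall a, A a -> B (f a)) ->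
  smooth_on A f -> smooth_on B g -> smooth_on A (g \o f).
Proof. by move=> oB AB sf sg k; exact: (times_differentiable_comp_rV oA oB AB). Qed.

Lemma smooth_on_comp_R Z (B : set R^o) (f : V -> R^o) (g : R^o -> Z) :
  open B -> (forall a, A a -> B (f a)) ->
  smooth_on A f -> smooth_on B g -> smooth_on A (g \o f).
Proof. by move=> oB AB sf sg k; exact: (times_differentiable_comp_R oA oB AB). Qed.

Lemma smooth_on_coord n (i : 'I_n) (f : V -> 'rV[R]_n) :
  smooth_on A f -> smooth_on A (fun x => f x 0 i : R^o).
Proof.
move=> sf k; apply: (times_differentiable_linear (L := rV_coord i) oA _ (sf k)).
by move=> x; exact: coord_continuous.
Qed.

Lemma smooth_on_prod n (f : 'I_n -> V -> R^o) :
  (forall i, smooth_on A (f i)) ->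
  smooth_on A (fun x => \prod_i f i x : R^o).
Proof.
elim: n f => [|n IH] f sf.
  rewrite (_ : (fun _ => _) = cst 1); first exact: smooth_on_cst.
  by apply/funext => x; rewrite big_ord0.
rewrite (_ : (fun _ => _) = fun x => f ord0 x *: (\prod_i f (lift ord0 i) x : R^o)).
  by apply: smooth_on_scale => //; exact: IH.
by apply/funext => x; rewrite big_ord_recl.
Qed.

Lemma smooth_on_sum_seq W (I : Type) (s : seq I) (f : I -> V -> W) :
  (forall i, smooth_on A (f i)) -> smooth_on A (fun x => \sum_(i <- s) f i x).
Proof.
move=> sf; elim: s => [|i s IH].
  rewrite (_ : (fun _ => _) = cst 0); first exact: smooth_on_cst.
  by apply/funext => x; rewrite big_nil.
rewrite (_ : (fun _ => _) = fun x => f i x + \sum_(i <- s) f i x).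
  exact: smooth_onD.
by apply/funext => x; rewrite big_cons.
Qed.

Lemma smooth_on_det n (G : V -> 'M[R]_n) :
  (forall i j, smooth_on A (fun x => G x i j : R^o)) ->
  smooth_on A (fun x => \det (G x) : R^o).
Proof.
move=> sG.
apply: (@smooth_on_sum_seq _ _ _ (fun (s : 'S_n) (x : V) =>
  (-1) ^+ s * \prod_i G x i (s i) : R^o)) => s.
apply: (@smooth_onM (fun=> (-1) ^+ s)); first exact: smooth_on_cst.
by apply: smooth_on_prod => i; exact: sG.
Qed.

(** Cramer's rule: the entries are cofactors divided by a determinant that does not vanish on
    [A]. *)
Lemma smooth_on_invmx n (G : V -> 'M[R]_n) :
  (forall i j, smooth_on A (fun x => G x i j : R^o)) ->
  (forall x, A x -> G x \in unitmx) ->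
  forall i j, smooth_on A (fun x => invmx (G x) i j : R^o).
Proof.
move=> sG uG i j; apply: (@smooth_on_eq _ (fun x =>
    (\det (G x))^-1 * ((-1) ^+ (j + i) * \det (row' j (col' i (G x)))) : R^o)).
  by move=> x Ax; rewrite /invmx uG // !mxE.
apply: smooth_onM; last first.
  apply: smooth_onM; first exact: smooth_on_cst.
  apply: smooth_on_det => k l.
  apply: smooth_on_eq (sG (lift j k) (lift i l)) => x _.
  by rewrite !mxE.
apply: (smooth_on_comp_R (g := GRing.inv) open_neq0) _ smooth_inv.
  by move=> x Ax /=; have := uG x Ax; rewrite unitmxE unitfE.
exact: smooth_on_det.
Qed.

End SmoothOn.

(* Freezing the second variable of f turns the directional derivative along v
   into the one along (v, 0). *)
Lemma smooth_on_slice (R : realType) (V W : normedModType R) (A : set (V * R^o))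
    (B : set V) (t : R^o) (f : V * R^o -> W) :
  (forall y, B y -> A (y, t)) -> smooth_on A f ->
  smooth_on B (fun y => f (y, t)).
Proof.
move=> BA sf k; elim: k f {sf}(sf k) => [//|k IH] f [df Df]; split=> [y By|v].
  apply: (differentiable_comp (f := fun y => (y, t)) (g := f)).
    by apply: differentiable_pair => //; exact: differentiable_cst.
  exact/df/BA.
rewrite (_ : (fun _ => _) = fun y => 'D_((v, 0) : V * R^o) f (y, t)).
  exact: (IH (fun z => 'D_((v, 0) : V * R^o) f z) (Df _)).
apply/funext => y; rewrite /derive.
suff -> : (fun h : R => h^-1 *: (((fun y => f (y, t)) \o shift y) (h *: v) - f (y, t))) =
    (fun h => h^-1 *: ((f \o shift (y, t)) (h *: ((v, 0) : V * R^o)) - f (y, t))) by [].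
apply/funext => h /=; congr (_ *: (f _ - _)).
by rewrite -[RHS]/(h *: v + y, h *: 0 + t) scaler0 add0r.
Qed.

(** * Tangent vectors and smooth fields in charts *)

Section Charts.
Variables (R : realType) (m : nat) (M : manifold R m).
Implicit Types (c : chart R m M) (p q : M) (A B : set M).

Lemma cmapK_dom c p : cdom c p -> cinv c (cmap c p) = p.
Proof. by move=> cp; apply: cmapK; rewrite inE. Qed.

Lemma chart_imageP c A y : (cmap c @` (A `&` cdom c)) y ->
  [/\ A (cinv c y), cdom c (cinv c y) & cmap c (cinv c y) = y].
Proof. by move=> [q [Aq cq] <-]; rewrite cmapK_dom. Qed.

(** Points near [cmap c p] lie in the open image of the chart, and continuity of [cinv c] there
    brings them back into [A]. *)
Lemma chart_image_near c A p : open A -> A p -> cdom c p ->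
  \forall y \near cmap c p, (cmap c @` (A `&` cdom c)) y.
Proof.
move=> oA Ap cp.
have cimg : (cmap c @` cdom c) (cmap c p) by exists p.
have near1 : \forall y \near cmap c p, (cmap c @` cdom c) y.
  by apply: open_nbhs_nbhs; split => //; exact: cimg_open.
have near2 : \forall y \near cmap c p, A (cinv c y).
  apply: (cinv_continuous (c := c) (mem_set cimg)).
  by rewrite cmapK_dom //; exact: open_nbhs_nbhs.
apply: filterS2 near1 near2 => y [q cq <-]; rewrite cmapK_dom // => Aq.
by exists q.
Qed.

Lemma chart_image_open c A : open A -> open (cmap c @` (A `&` cdom c)).
Proof.
move=> oA; rewrite openE => y [q [Aq cq] <-]; exact: chart_image_near.
Qed.

Lemma trans_smooth c c' : atlas c -> atlas c' ->
  smooth_on (cmap c @` (cdom c' `&` cdom c)) (cmap c' \o cinv c).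
Proof. by move=> ac ac'; rewrite setIC; exact: atlas_compatible. Qed.

Lemma trans_differentiable c c' p : atlas c -> atlas c' -> cdom c p ->
  cdom c' p -> differentiable (cmap c' \o cinv c) (cmap c p).
Proof.
move=> ac ac' cp c'p; apply: smooth_on_differentiable (trans_smooth ac ac') _.
by exists p.
Qed.

Lemma near_chart_change (W : Type) (F : M -> W) c c' p : cdom c p -> cdom c' p ->
  \forall y \near cmap c' p,
    ((F \o cinv c) \o (cmap c \o cinv c')) y = (F \o cinv c') y.
Proof.
move=> cp c'p; apply: filterS (chart_image_near (cdom_open c) cp c'p) => y.
by move=> /chart_imageP[cy c'y yE] /=; rewrite cmapK_dom.
Qed.

Section ChartChange.
Variables (W : normedModType R) (F : M -> W) (c c' : chart R m M) (p : M).
Hypotheses (ac : atlas c) (ac' : atlas c') (cp : cdom c p) (c'p : cdom c' p).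
Hypothesis dF : differentiable (F \o cinv c) (cmap c p).

Let dtrans : differentiable (cmap c \o cinv c') (cmap c' p) :=
  trans_differentiable ac' ac c'p cp.

Let dF' : differentiable (F \o cinv c) ((cmap c \o cinv c') (cmap c' p)).
Proof.
have E : cmap c p = (cmap c \o cinv c') (cmap c' p).
  exact: esym (congr1 (cmap c) (cmapK_dom c'p)).
exact: (eq_ind _ (fun y => differentiable (F \o cinv c) y) dF _ E).
Qed.

Let dcomp : differentiable ((F \o cinv c) \o (cmap c \o cinv c')) (cmap c' p) :=
  differentiable_comp dtrans dF'.

(** Chain rule along the transition map; the two chart expressions agree only near [cmap c' p],
    which suffices by [near_eq_diff]. *)
Lemma diff_chart_change x : 'd (F \o cinv c') (cmap c' p) x =
  'd (F \o cinv c) (cmap c p) ('d (cmap c \o cinv c') (cmap c' p) x).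
Proof.
apply: (etrans (near_eq_diff (near_chart_change F cp c'p) dcomp x)).
apply: (etrans (diff_compE x dtrans dF')).
by rewrite /= (cmapK_dom c'p).
Qed.

End ChartChange.

Lemma diff_chart_id c p x : cdom c p -> 'd (cmap c \o cinv c) (cmap c p) x = x.
Proof.
move=> cp.
have E : \forall y \near cmap c p, id y = (cmap c \o cinv c) y.
  apply: filterS (chart_image_near (cdom_open c) cp cp) => y.
  by move=> /chart_imageP[].
have did : is_diff (cmap c p) id id := is_diff_id _.
have [d1 d2] := did.
by rewrite (near_eq_diff E d1 x) d2.
Qed.

Lemma tcoordD c p x y : tcoord c p (x + y) = tcoord c p x + tcoord c p y.
Proof. by rewrite /tcoord linearD. Qed.

Lemma tcoordZ c p a x : tcoord c p (a *: x) = a *: tcoord c p x.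
Proof. by rewrite /tcoord linearZ. Qed.

Lemma dfunD_vec (f : M -> R) p x y : dfun f p (x + y) = dfun f p x + dfun f p y.
Proof. by rewrite /dfun linearD. Qed.

Lemma dfunZ_vec (f : M -> R) p a x : dfun f p (a *: x) = a * dfun f p x.
Proof. by rewrite /dfun linearZ. Qed.

(* The field with constant coordinates y in the chart c; meaningless off cdom c. *)
Definition coord_field c (y : 'rV[R]_m) : vector_field M :=
  fun q => 'd (cmap (chart_at q) \o cinv c) (cmap c q) y.

Lemma tcoord_coord_field c c' q y : atlas c -> atlas c' -> cdom c q -> cdom c' q ->
  tcoord c' q (coord_field c y q) = 'd (cmap c' \o cinv c) (cmap c q) y.
Proof.
move=> ac ac' cq c'q.
rewrite (diff_chart_change (F := cmap c') (chart_at_atlas q) ac (chart_at_dom q) cq) //.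
by apply: trans_differentiable => //; [exact: chart_at_atlas|exact: chart_at_dom].
Qed.

Lemma coord_fieldK c q y : atlas c -> cdom c q -> tcoord c q (coord_field c y q) = y.
Proof. by move=> ac cq; rewrite tcoord_coord_field // diff_chart_id. Qed.

Lemma tcoordK c q x : atlas c -> cdom c q -> coord_field c (tcoord c q x) q = x.
Proof.
move=> ac cq.
have aq := chart_at_atlas q; have dq := chart_at_dom q.
have dt : differentiable (cmap (chart_at q) \o cinv c) (cmap c q).
  exact: trans_differentiable.
exact: (etrans (esym (diff_chart_change (F := cmap (chart_at q)) ac aq cq dq dt x))
  (diff_chart_id x dq)).
Qed.

(** Seen in a chart [c'], the coordinates are the derivative along [y] of one transition map,
    composed with the inverse transition. These fields supply the local frames and the extensions of
    tangent vectors. *)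
Lemma smooth_coord_field c y : atlas c -> smooth_field (cdom c) (coord_field c y).
Proof.
move=> ac c' ac'.
have o1 : open (cmap c' @` (cdom c `&` cdom c')) by apply/chart_image_open/cdom_open.
have o2 : open (cmap c @` (cdom c' `&` cdom c)) by apply/chart_image_open/cdom_open.
apply: (smooth_on_eq o1 (f := (fun z => 'D_y (cmap c' \o cinv c) z) \o (cmap c \o cinv c'))).
  move=> z /chart_imageP[cz c'z zE] /=.
  rewrite deriveE ?tcoord_coord_field //.
  exact: trans_differentiable.
apply: (smooth_on_comp_rV o1 o2 _ (trans_smooth ac' ac)).
  by move=> z /chart_imageP[cz c'z zE] /=; exists (cinv c' z).
exact/smooth_on_derive/trans_smooth.
Qed.

Section SmoothFunctions.
Variable A : set M.
Hypothesis oA : open A.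
Implicit Types (f h : M -> R) (X Y : vector_field M).

Let oI c : open (cmap c @` (A `&` cdom c)) := @chart_image_open c A oA.

Lemma smooth_function_sub B f : A `<=` B -> smooth_function B f -> smooth_function A f.
Proof.
move=> AB sf c ac; apply: smooth_on_sub (sf c ac) => y [q [Aq cq] <-].
by exists q; split => //; exact: AB.
Qed.

Lemma smooth_field_sub B X : A `<=` B -> smooth_field B X -> smooth_field A X.
Proof.
move=> AB sX c ac; apply: smooth_on_sub (sX c ac) => y [q [Aq cq] <-].
by exists q; split => //; exact: AB.
Qed.

Lemma smooth_function_eq f h : (forall p, A p -> f p = h p) ->
  smooth_function A f -> smooth_function A h.
Proof.
move=> fh sf c ac; apply: (smooth_on_eq _ _ (sf c ac)) => // y /chart_imageP[Ay _ _] /=.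
exact: fh.
Qed.

Lemma smooth_function_cst a : smooth_function A (fun=> a).
Proof. by move=> c ac; exact: smooth_on_cst. Qed.

Lemma smooth_functionD f h : smooth_function A f -> smooth_function A h ->
  smooth_function A (fun p => f p + h p).
Proof. by move=> sf sh c ac; exact: (smooth_onD (@oI c) (sf c ac) (sh c ac)). Qed.

Lemma smooth_functionM f h : smooth_function A f -> smooth_function A h ->
  smooth_function A (fun p => f p * h p).
Proof. by move=> sf sh c ac; exact: (smooth_onM (@oI c) (sf c ac) (sh c ac)). Qed.

Lemma smooth_functionN f : smooth_function A f -> smooth_function A (fun p => - f p).
Proof.
move=> sf; apply: (@smooth_function_eq (fun p => (-1) * f p)).
  by move=> p _; rewrite mulN1r.
by apply: smooth_functionM => //; exact: smooth_function_cst.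
Qed.

Lemma smooth_functionB f h : smooth_function A f -> smooth_function A h ->
  smooth_function A (fun p => f p - h p).
Proof. by move=> sf sh; apply: smooth_functionD => //; exact: smooth_functionN. Qed.

Lemma smooth_function_comp (k : R -> R) f : smooth_on setT (k : R^o -> R^o) ->
  smooth_function A f -> smooth_function A (fun p => k (f p)).
Proof.
move=> sk sf c ac.
exact: (@smooth_on_comp_R _ _ _ (@oI c) _ setT (f \o cinv c) k openT (fun _ _ => I) (sf c ac) sk).
Qed.

Lemma smooth_fieldD X Y : smooth_field A X -> smooth_field A Y ->
  smooth_field A (fun p => X p + Y p).
Proof.
move=> sX sY c ac; apply: (smooth_on_eq (@oI c) _ (smooth_onD (@oI c) (sX c ac) (sY c ac))).
by move=> y _; rewrite tcoordD.
Qed.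

Lemma smooth_fieldZ f X : smooth_function A f -> smooth_field A X ->
  smooth_field A (fun p => f p *: X p).
Proof.
move=> sf sX c ac; apply: (smooth_on_eq (@oI c) _ (smooth_on_scale (@oI c) (sf c ac) (sX c ac))).
by move=> y _; rewrite /= tcoordZ.
Qed.

Lemma smooth_fieldN X : smooth_field A X -> smooth_field A (fun p => - X p).
Proof.
move=> sX; rewrite (_ : (fun _ => _) = fun p => (-1) *: X p).
  by apply: smooth_fieldZ => //; exact: smooth_function_cst.
by apply/funext => p; rewrite scaleN1r.
Qed.

Lemma smooth_fieldB X Y : smooth_field A X -> smooth_field A Y ->
  smooth_field A (fun p => X p - Y p).
Proof. by move=> sX sY; apply: smooth_fieldD => //; exact: smooth_fieldN. Qed.

Lemma smooth_function_differentiable c f p : atlas c -> cdom c p -> A p ->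
  smooth_function A f -> differentiable (f \o cinv c : _ -> R^o) (cmap c p).
Proof.
move=> ac cp Ap sf; apply: smooth_on_differentiable (sf c ac) _; by exists p.
Qed.

Lemma dfun_chart c f p x : atlas c -> cdom c p -> A p -> smooth_function A f ->
  dfun f p x = 'd (f \o cinv c : _ -> R^o) (cmap c p) (tcoord c p x).
Proof.
move=> ac cp Ap sf.
apply: (@diff_chart_change R^o f) => //.
- exact: chart_at_atlas.
- exact: chart_at_dom.
- exact: smooth_function_differentiable.
Qed.

(** In a chart, $X f$ is the sum of the coordinates of [X] times the partial derivatives of [f]. *)
Lemma smooth_function_dfun f X : smooth_function A f -> smooth_field A X ->
  smooth_function A (fun p => dfun f p (X p)).
Proof.
move=> sf sX c ac.
apply: (smooth_on_eq (@oI c) (f := fun y => \sum_(i < m)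
   (tcoord c (cinv c y) (X (cinv c y)) 0 i : R^o) *:
     ('D_(delta_mx 0 i) (f \o cinv c : _ -> R^o) y : R^o))).
  move=> y Iy; have [Ay cy yE] := chart_imageP Iy.
  rewrite /= (dfun_chart _ ac cy Ay sf) yE.
  rewrite [in RHS](row_sum_delta (tcoord _ _ _)) linear_sum.
  apply: eq_bigr => i _; rewrite linearZ deriveE //.
  exact: smooth_on_differentiable (sf c ac) Iy.
apply: (smooth_on_sum (@oI c)) => i; apply: (smooth_on_scale (@oI c)).
  exact: (smooth_on_coord (@oI c) i (sX c ac)).
exact/smooth_on_derive/sf.
Qed.

End SmoothFunctions.
End Charts.

(** * Rules of differential calculus for functions at a point *)

Section DfunCalculus.
Variables (R : realType) (m : nat) (M : manifold R m) (A : set M) (p : M).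
Hypotheses (oA : open A) (Ap : A p).
Implicit Types (f h : M -> R) (x : 'rV[R]_m).

Let diffble f : smooth_function A f ->
  differentiable (f \o cinv (chart_at p) : _ -> R^o) (Defs.coord0 p) :=
  smooth_function_differentiable (chart_at_atlas p) (chart_at_dom p) Ap.

Let coord0K : cinv (chart_at p) (Defs.coord0 p) = p := cmapK_dom (chart_at_dom p).

Lemma dfun_cst (a : R) x : dfun (fun=> a : R) p x = 0.
Proof.
rewrite /dfun; have E := @diff_cst R 'rV[R]_m R^o (a : R^o) (Defs.coord0 p).
exact: (congr1 (fun k : _ -> _ => k x) E).
Qed.

Lemma dfunD f h x : smooth_function A f -> smooth_function A h ->
  dfun (fun q => f q + h q) p x = dfun f p x + dfun h p x.
Proof.
move=> sf sh.
exact: (congr1 (fun k : _ -> _ => k x) (diffD (diffble sf) (diffble sh))).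
Qed.

Lemma dfunM f h x : smooth_function A f -> smooth_function A h ->
  dfun (fun q => f q * h q) p x = f p * dfun h p x + dfun f p x * h p.
Proof.
move=> sf sh; have [_ E] := is_diff_scale (diffble sf) (diffble sh).
by have := congr1 (fun k : _ -> _ => k x) E; rewrite /= coord0K.
Qed.

Lemma dfun_comp (k : R -> R) f x k' : smooth_function A f -> is_derive (f p) 1 k k' ->
  dfun (fun q => k (f q)) p x = k' * dfun f p x.
Proof.
move=> sf Dk; have [dk kE] := diff_of_is_derive (Dk : is_derive (f p) 1 (k : R^o -> R^o) k').
have dk' : differentiable (k : R^o -> R^o) ((f \o cinv (chart_at p)) (Defs.coord0 p)).
  by rewrite /= coord0K.
have := diff_compE x (diffble sf) dk'; rewrite /= coord0K kE mulrC.
by [].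
Qed.

Lemma dfunN f x : smooth_function A f ->
  dfun (fun q => - f q) p x = - dfun f p x.
Proof.
move=> sf.
exact: (congr1 (fun k : _ -> _ => k x) (diffN (diffble sf))).
Qed.

Lemma dfunB f h x : smooth_function A f -> smooth_function A h ->
  dfun (fun q => f q - h q) p x = dfun f p x - dfun h p x.
Proof.
move=> sf sh.
by rewrite dfunD ?dfunN //; exact: smooth_functionN.
Qed.

End DfunCalculus.

(** * Extension of tangent vectors, nondegeneracy and Gram matrices *)

Section Extension.
Variables (R : realType) (m : nat) (M : manifold R m).

(** Connections act on fields, whereas the identities sought hold at a point; vectors at [p] are
    extended with constant coordinates in the preferred chart. *)
Lemma field_extension (p : M) (x : 'rV[R]_m) :
  exists2 X : vector_field M, smooth_field (cdom (chart_at p)) X & X p = x.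
Proof.
have ap := chart_at_atlas p.
exists (coord_field (chart_at p) (tcoord (chart_at p) p x)).
  exact: smooth_coord_field.
by rewrite tcoordK //; exact: chart_at_dom.
Qed.

(** Torsion-freeness is stated through the action on functions; using the chart coordinates as test
    functions recovers the vectors themselves. *)
Lemma dfun_inj (p : M) (x y : 'rV[R]_m) :
  (forall A f, open A -> A p -> smooth_function A f -> dfun f p x = dfun f p y) ->
  x = y.
Proof.
move=> H; have ap := chart_at_atlas p; have dp := chart_at_dom p.
apply/rowP => i.
have sf : smooth_function (cdom (chart_at p)) (fun q => cmap (chart_at p) q 0 i).
  move=> c ac; have oI := @chart_image_open _ _ _ c _ (cdom_open (chart_at p)).
  exact: (smooth_on_coord oI i (trans_smooth ac ap)).
have E z : dfun (fun q => cmap (chart_at p) q 0 i) p z = z 0 i.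
  have dt := trans_differentiable ap ap dp dp.
  pose L : {linear 'rV[R]_m -> R^o} := @rV_coord R m i.
  have cl : continuous L by move=> w; exact: coord_continuous.
  have dl w := linear_differentiable w cl.
  apply: (etrans (diff_compE (g := L) z dt (dl _))).
  by rewrite diff_chart_id // (diff_lin _ cl).
by rewrite -!E; apply: H sf; [exact: cdom_open|exact: dp].
Qed.

Variables (s t : nat) (g : M -> 'rV[R]_m -> 'rV[R]_m -> R).
Hypothesis gP : pseudo_riemannian s t g.

Lemma metricDl p x y z : g p (x + y) z = g p x z + g p y z.
Proof. by rewrite -[x in LHS]scale1r (metric_linear gP) mul1r. Qed.

Lemma metric0l p z : g p 0 z = 0.
Proof. by apply: (addrI (g p 0 z)); rewrite -metricDl !addr0. Qed.

Lemma metricZl p a x z : g p (a *: x) z = a * g p x z.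
Proof. by rewrite -[a *: x]addr0 (metric_linear gP) metric0l addr0. Qed.

Lemma metricNl p x z : g p (- x) z = - g p x z.
Proof. by rewrite -scaleN1r metricZl mulN1r. Qed.

Lemma metricDr p x y z : g p z (x + y) = g p z x + g p z y.
Proof. by rewrite !(Defs.metric_sym gP p z) metricDl. Qed.

Lemma metricZr p a x z : g p z (a *: x) = a * g p z x.
Proof. by rewrite !(Defs.metric_sym gP p z) metricZl. Qed.

Lemma metricNr p x z : g p z (- x) = - g p z x.
Proof. by rewrite !(Defs.metric_sym gP p z) metricNl. Qed.

Lemma metric_suml p n (X : 'I_n -> 'rV[R]_m) z :
  g p (\sum_i X i) z = \sum_i g p (X i) z.
Proof. by apply: (big_morph (fun x => g p x z)) => [x y|]; [exact: metricDl|exact: metric0l]. Qed.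

(** Pairing [x] with a vector of the orthonormal frame returns the corresponding coefficient of [x]
    up to sign. *)
Lemma metric_nondegenerate p x : (forall z, g p x z = 0) -> x = 0.
Proof.
move=> x0; have [_ [B uB BE]] := metric_signature gP p.
have xE : x = \sum_i (x *m invmx B) 0 i *: row i B.
  by rewrite -[LHS](mulmxKV uB) mulmx_sum_row.
rewrite xE big1 // => i _.
have := x0 (row i B); rewrite {1}xE metric_suml (bigD1 i) //= big1 ?addr0.
  rewrite metricZl BE eqxx => /eqP; rewrite mulf_eq0 => /orP[/eqP ->|].
    by rewrite scale0r.
  by case: ifP => _; rewrite ?oppr_eq0 oner_eq0.
by move=> j /negPf ji; rewrite metricZl BE ji mulr0.
Qed.

Lemma metric_inj p x y : (forall z, g p x z = g p y z) -> x = y.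
Proof.
move=> xy; apply/subr0_eq/(@metric_nondegenerate p) => z.
by rewrite metricDl metricNl xy subrr.
Qed.

(* The Gram matrix of the coordinate frame expresses the coordinates of U through
   its pairings with the frame. *)
Lemma smooth_field_dual A (U : vector_field M) : open A ->
  (forall B X, open B -> B `<=` A -> smooth_field B X ->
     smooth_function B (fun q => g q (U q) (X q))) ->
  smooth_field A U.
Proof.
move=> oA H c ac.
have oI := @chart_image_open _ _ _ c _ oA.
pose E i : vector_field M := coord_field c (delta_mx 0 i).
pose B := A `&` cdom c.
have oB : open B by apply: openI => //; exact: cdom_open.
have IB : cmap c @` (B `&` cdom c) = cmap c @` (A `&` cdom c).
  by rewrite /B -setIA setIid.
have sE i : smooth_field B (E i).
  by apply: smooth_field_sub (smooth_coord_field _ ac) => q [].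
pose G y : 'M[R]_m := \matrix_(i, j) g (cinv c y) (E i (cinv c y)) (E j (cinv c y)).
pose b y : 'rV[R]_m := \row_j g (cinv c y) (U (cinv c y)) (E j (cinv c y)).
have sG i j : smooth_on (cmap c @` (A `&` cdom c)) (fun y => G y i j : R^o).
  rewrite -IB.
  apply: smooth_on_eq (metric_smooth gP oB (sE i) (sE j) ac).
    exact: chart_image_open.
  by move=> y _; rewrite mxE.
have sb j : smooth_on (cmap c @` (A `&` cdom c)) (fun y => b y 0 j : R^o).
  rewrite -IB.
  apply: smooth_on_eq (H B (E j) oB (fun q Bq => proj1 Bq) (sE j) c ac).
    exact: chart_image_open.
  by move=> y _; rewrite mxE.
have expand y x : cdom c (cinv c y) ->
    x = \sum_i tcoord c (cinv c y) x 0 i *: E i (cinv c y).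
  move=> cy; rewrite -[LHS](tcoordK _ ac cy) [in LHS](row_sum_delta (tcoord _ _ _)).
  rewrite /coord_field linear_sum; apply: eq_bigr => i _.
  by rewrite linearZ.
have gE y x j : cdom c (cinv c y) ->
    g (cinv c y) x (E j (cinv c y)) = (tcoord c (cinv c y) x *m G y) 0 j.
  move=> cy; rewrite {1}(expand y x cy) metric_suml mxE.
  by apply: eq_bigr => i _; rewrite metricZl mxE.
(* A row vector in the kernel of the Gram matrix is the coordinate vector of a tangent vector
   orthogonal to the whole frame, hence zero. *)
have uG y : (cmap c @` (A `&` cdom c)) y -> G y \in unitmx.
  move=> /chart_imageP[Ay cy yE].
  rewrite -row_free_unit -kermx_eq0; apply/eqP/row_matrixP => i.
  rewrite row0; set v := row i _.
  have v0 : v *m G y = 0 by rewrite /v -row_mul mulmx_ker row0.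
  pose x := coord_field c v (cinv c y).
  have tx : tcoord c (cinv c y) x = v by rewrite coord_fieldK.
  suff x0 : x = 0 by rewrite -tx x0 /tcoord linear0.
  apply: (@metric_nondegenerate (cinv c y)) => z.
  rewrite (Defs.metric_sym gP) (expand y z cy) metric_suml big1 // => j _.
  by rewrite metricZl (Defs.metric_sym gP) gE // tx v0 mxE mulr0.
(* Since [b] is the product of the coordinates of [U] with the Gram matrix, these coordinates are
   [b *m invmx G], with smooth entries. *)
apply: (smooth_on_eq oI (f := fun y => \sum_j
   ((\sum_i b y 0 i * invmx (G y) i j) : R^o) *: delta_mx 0 j)).
  move=> y Iy; have [Ay cy yE] := chart_imageP Iy.
  rewrite [RHS]row_sum_delta; apply: eq_bigr => j _; congr (_ *: _).
  suff -> : tcoord c (cinv c y) (U (cinv c y)) = b y *m invmx (G y) by rewrite mxE.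
  have -> : b y = tcoord c (cinv c y) (U (cinv c y)) *m G y.
    by apply/rowP => k; rewrite mxE gE.
  by rewrite mulmxK // uG.
apply: (smooth_on_sum oI) => j; apply: (smooth_on_scale oI); last exact: smooth_on_cst.
apply: (smooth_on_sum oI) => i.
apply: (smooth_onM oI (sb i)); exact: smooth_on_invmx.
Qed.

End Extension.

(** * The covariant derivative of phi on Sasaki-like manifolds *)

Section AlmostContact.
Variables (R : realType) (n : nat) (M : manifold R (2 * n).+1).
Local Notation T := 'rV[R]_(2 * n).+1.
Variables (phi : M -> T -> T) (xi : M -> T) (eta : M -> T -> R).
Variable (g : M -> T -> T -> R).
Hypothesis acc : almost_contact_complex_riemannian phi xi eta g.
Implicit Types (p q : M) (x y z : T) (A : set M) (X Y Z : vector_field M).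

Lemma phi_linear p a x y : phi p (a *: x + y) = a *: phi p x + phi p y.
Proof. exact: (ac_phi acc).1. Qed.

Lemma phiD p x y : phi p (x + y) = phi p x + phi p y.
Proof. by rewrite -[x in LHS]scale1r phi_linear scale1r. Qed.

Lemma phi0 p : phi p 0 = 0.
Proof. by apply: (addrI (phi p 0)); rewrite -phiD !addr0. Qed.

Lemma phiZ p a x : phi p (a *: x) = a *: phi p x.
Proof. by rewrite -[a *: x]addr0 phi_linear phi0 addr0. Qed.

Lemma phiN p x : phi p (- x) = - phi p x.
Proof. by rewrite -scaleN1r phiZ scaleN1r. Qed.

Lemma eta_linear p a x y : eta p (a *: x + y) = a * eta p x + eta p y.
Proof. exact: (ac_eta acc).1. Qed.

Lemma etaD p x y : eta p (x + y) = eta p x + eta p y.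
Proof. by rewrite -[x in LHS]scale1r eta_linear mul1r. Qed.

Lemma eta0 p : eta p 0 = 0.
Proof. by apply: (addrI (eta p 0)); rewrite -etaD !addr0. Qed.

Lemma etaZ p a x : eta p (a *: x) = a * eta p x.
Proof. by rewrite -[a *: x]addr0 eta_linear eta0 addr0. Qed.

Lemma etaN p x : eta p (- x) = - eta p x.
Proof. by rewrite -scaleN1r etaZ mulN1r. Qed.

Definition metric_expand := (metricDl (ac_g acc), metricDr (ac_g acc),
  metricZl (ac_g acc), metricZr (ac_g acc), metricNl (ac_g acc), metricNr (ac_g acc)).

Lemma metric_xi p x : g p x (xi p) = eta p x.
Proof.
have := ac_g_phi acc p x (xi p).
rewrite (ac_phi_xi acc) (ac_eta_xi acc) mulr1 (Defs.metric_sym (ac_g acc)).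
by rewrite (metric0l (ac_g acc)) => /eqP; rewrite eq_sym addrC subr_eq0 => /eqP ->.
Qed.

Lemma metric_xil p x : g p (xi p) x = eta p x.
Proof. by rewrite (Defs.metric_sym (ac_g acc)) metric_xi. Qed.

(** Put [phi y] for [y] in [ac_g_phi] and expand [phi (phi y)]. Hence [g] and [g(., phi .)] are both
    symmetric, as parts of a complex bilinear form on [ker eta]. *)
Lemma metric_phiC p x y : g p (phi p x) y = g p x (phi p y).
Proof.
have := ac_g_phi acc p x (phi p y).
rewrite (ac_phi_phi acc) (ac_eta_phi acc) mulr0 addr0 !metric_expand metric_xi.
by rewrite (ac_eta_phi acc) mulr0 addr0 => /oppr_inj.
Qed.

Definition hor (X : vector_field M) : vector_field M :=
  fun q => X q - eta q (X q) *: xi q.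

Lemma hor_add X : X = fun q => hor X q + eta q (X q) *: xi q.
Proof. by apply/funext => q; rewrite /hor subrK. Qed.

Lemma eta_hor p X : eta p (hor X p) = 0.
Proof. by rewrite /hor etaD etaN etaZ (ac_eta_xi acc) mulr1 subrr. Qed.

Lemma smooth_xi A : smooth_field A (xi : vector_field M).
Proof. exact: smooth_field_sub (@subsetT _ _) (ac_xi acc). Qed.

Lemma smooth_eta A X : open A -> smooth_field A X ->
  smooth_function A (fun q => eta q (X q)).
Proof. exact: (ac_eta acc).2. Qed.

Lemma smooth_phi A X : open A -> smooth_field A X ->
  smooth_field A (fun q => phi q (X q)).
Proof. exact: (ac_phi acc).2. Qed.

Lemma smooth_metric A X Y : open A -> smooth_field A X -> smooth_field A Y ->
  smooth_function A (fun q => g q (X q) (Y q)).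
Proof. exact: (metric_smooth (ac_g acc)). Qed.

Lemma hor_in_H A X : open A -> smooth_field A X -> in_H eta A (hor X).
Proof.
move=> oA sX; split=> [|p _]; last exact: eta_hor.
apply: smooth_fieldB => //; apply: smooth_fieldZ => //; last exact: smooth_xi.
exact: smooth_eta.
Qed.

Section Connection.
Variable nabla : vector_field M -> vector_field M -> vector_field M.
Hypothesis lc : levi_civita g nabla.

Definition nabla_phi X Y : vector_field M :=
  fun p => nabla X (fun q => phi q (Y q)) p - phi p (nabla X Y p).

Let cn : connection nabla. Proof. by case: lc. Qed.
Let mc : metric_compatible g nabla. Proof. by case: lc. Qed.

Section Local.
Variables (A : set M) (p : M).
Hypotheses (oA : open A) (Ap : A p).

Lemma connection0r X : smooth_field A X -> nabla X (fun=> 0) p = 0.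
Proof.
move=> sX; rewrite (_ : (fun=> 0) = fun q => (0 : R) *: xi q); last first.
  by apply/funext => q; rewrite scale0r.
have s0 := smooth_function_cst A (0 : R).
by rewrite (connectionZr cn oA Ap s0 sX (smooth_xi A)) dfun_cst !scale0r addr0.
Qed.

Lemma nabla_phiDl X X' Y : smooth_field A X -> smooth_field A X' -> smooth_field A Y ->
  nabla_phi (fun q => X q + X' q) Y p = nabla_phi X Y p + nabla_phi X' Y p.
Proof.
move=> sX sX' sY; rewrite /nabla_phi.
rewrite (connectionDl cn oA Ap sX sX' (smooth_phi oA sY)).
by rewrite (connectionDl cn oA Ap sX sX' sY) phiD opprD addrACA.
Qed.

Lemma nabla_phiZl f X Y : smooth_function A f -> smooth_field A X -> smooth_field A Y ->
  nabla_phi (fun q => f q *: X q) Y p = f p *: nabla_phi X Y p.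
Proof.
move=> sf sX sY; rewrite /nabla_phi.
rewrite (connectionZl cn oA Ap sf sX (smooth_phi oA sY)).
by rewrite (connectionZl cn oA Ap sf sX sY) phiZ scalerBr.
Qed.

Lemma nabla_phiDr X Y Y' : smooth_field A X -> smooth_field A Y -> smooth_field A Y' ->
  nabla_phi X (fun q => Y q + Y' q) p = nabla_phi X Y p + nabla_phi X Y' p.
Proof.
move=> sX sY sY'; rewrite /nabla_phi.
rewrite (_ : (fun q => phi q _) = fun q => phi q (Y q) + phi q (Y' q)); last first.
  by apply/funext => q; rewrite phiD.
rewrite (connectionDr cn oA Ap sX (smooth_phi oA sY) (smooth_phi oA sY')).
by rewrite (connectionDr cn oA Ap sX sY sY') phiD opprD addrACA.
Qed.

(** The two terms in the derivative of [f] cancel, so [nabla_phi] is tensorial in its second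
    argument as well. *)
Lemma nabla_phiZr f X Y : smooth_function A f -> smooth_field A X -> smooth_field A Y ->
  nabla_phi X (fun q => f q *: Y q) p = f p *: nabla_phi X Y p.
Proof.
move=> sf sX sY; rewrite /nabla_phi.
rewrite (_ : (fun q => phi q _) = fun q => f q *: phi q (Y q)); last first.
  by apply/funext => q; rewrite phiZ.
rewrite (connectionZr cn oA Ap sf sX (smooth_phi oA sY)).
rewrite (connectionZr cn oA Ap sf sX sY) phiD !phiZ opprD addrACA subrr add0r.
by rewrite scalerBr.
Qed.

(** Both sides of [g (phi Y) Z = g Y (phi Z)] are differentiated along [X] by metric
    compatibility. *)
Lemma nabla_phi_sym X Y Z : smooth_field A X -> smooth_field A Y -> smooth_field A Z ->
  g p (nabla_phi X Y p) (Z p) = g p (nabla_phi X Z p) (Y p).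
Proof.
move=> sX sY sZ.
have H1 := mc oA Ap sX (smooth_phi oA sY) sZ.
have H2 := mc oA Ap sX sY (smooth_phi oA sZ).
have E : (fun q => g q (phi q (Y q)) (Z q)) = (fun q => g q (Y q) (phi q (Z q))).
  by apply/funext => q; rewrite metric_phiC.
rewrite E H2 in H1.
rewrite /nabla_phi !metric_expand (Defs.metric_sym (ac_g acc) p (nabla X (fun q => phi q (Z q)) p)).
rewrite !metric_phiC (Defs.metric_sym (ac_g acc) p (nabla X Z p)).
by rewrite -metric_phiC; move: H1; rewrite -!metric_phiC; lra.
Qed.

Lemma nabla_phi_xi_xi X : smooth_field A X -> g p (nabla_phi X xi p) (xi p) = 0.
Proof.
move=> sX; rewrite /nabla_phi metric_xi etaD etaN (ac_eta_phi acc) subr0.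
rewrite (_ : (fun q => phi q (xi q)) = fun=> 0); last first.
  by apply/funext => q; rewrite (ac_phi_xi acc).
by rewrite connection0r // eta0.
Qed.

Lemma eta_nabla X Y : smooth_field A X -> smooth_field A Y ->
  dfun (fun q => eta q (Y q)) p (X p) = eta p (nabla X Y p) + g p (Y p) (nabla X xi p).
Proof.
move=> sX sY; have := mc oA Ap sX sY (smooth_xi A).
rewrite metric_xi => <-.
suff -> : (fun q => eta q (Y q)) = fun q => g q (Y q) (xi q) by [].
by apply/funext => q; rewrite metric_xi.
Qed.

End Local.

Definition sasaki_condition := forall A X Y Z p, open A -> A p ->
  in_H eta A X -> in_H eta A Y -> in_H eta A Z ->
  [/\ Ftensor phi g nabla X Y Z p = 0,
      Ftensor phi g nabla xi Y Z p = 0,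
      Ftensor phi g nabla xi xi Z p = 0 &
      Ftensor phi g nabla X Y xi p = - g p (X p) (Y p)].

Definition sasaki_formula := forall A X Y p, open A -> A p ->
  smooth_field A X -> smooth_field A Y ->
  nabla_phi X Y p = - g p (X p) (Y p) *: xi p - eta p (Y p) *: X p +
    (2 * eta p (X p) * eta p (Y p)) *: xi p.

Lemma sasaki_formula_condition : sasaki_formula -> sasaki_condition.
Proof.
move=> H A X Y Z p oA Ap [sX X0] [sY Y0] [sZ Z0].
have sxi := smooth_xi A.
have FE U V W : Ftensor phi g nabla U V W p = g p (nabla_phi U V p) (W p) by [].
split; rewrite FE (H A) // !metric_expand !metric_xil ?metric_xi ?X0 ?Y0 ?Z0
  ?(ac_eta_xi acc) //; ring.
Qed.

Lemma sasaki_condition_formula : sasaki_condition -> sasaki_formula.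
Proof.
move=> H A0 X Y p oA0 A0p sX0 sY0.
apply: (metric_inj (ac_g acc) (p := p)) => z.
have [Z sZ0 <-] := field_extension p z.
(* The extension [Z] of [z] is smooth only on the chart domain. *)
pose A := A0 `&` cdom (chart_at p).
have oA : open A by apply: openI => //; exact: cdom_open.
have Ap : A p by split => //; exact: chart_at_dom.
have sX : smooth_field A X by apply: smooth_field_sub sX0 => q [].
have sY : smooth_field A Y by apply: smooth_field_sub sY0 => q [].
have sZ : smooth_field A Z by apply: smooth_field_sub sZ0 => q [].
have sxi := smooth_xi A.
have FE U V W : Ftensor phi g nabla U V W p = g p (nabla_phi U V p) (W p) by [].
have hX := hor_in_H oA sX; have [shX _] := hX.
have hY := hor_in_H oA sY; have [shY _] := hY.
have hZ := hor_in_H oA sZ; have [shZ _] := hZ.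
have [seX seY] := (smooth_eta oA sX, smooth_eta oA sY).
(* Splitting each argument into its part in [ker eta] and its part along [xi] gives eight components
   of F. Four come from the condition directly, [F5] and [F6] from it by symmetry in the last two
   arguments, and [F7], [F8] vanish because [phi xi = 0] and [eta o phi = 0]. *)
have [F1 F2 F3 F4] := H A _ _ _ p oA Ap hX hY hZ; rewrite !FE in F1 F2 F3 F4.
have [_ _ F6 F5] := H A _ _ _ p oA Ap hX hZ hY; rewrite !FE in F5 F6.
rewrite (nabla_phi_sym oA Ap shX shZ sxi) in F5.
rewrite (nabla_phi_sym oA Ap sxi sxi shY) in F6.
have F7 := nabla_phi_xi_xi oA Ap shX.
have F8 := nabla_phi_xi_xi oA Ap sxi.
have scal U f : smooth_field A U -> smooth_function A f -> smooth_field A (fun q => f q *: U q).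
  by move=> sU sf; exact: smooth_fieldZ.
have -> : nabla_phi X Y p = nabla_phi (hor X) (hor Y) p
   + eta p (Y p) *: nabla_phi (hor X) xi p
   + eta p (X p) *: nabla_phi xi (hor Y) p
   + (eta p (X p) * eta p (Y p)) *: nabla_phi xi xi p.
  have splitr U : smooth_field A U ->
      nabla_phi U Y p = nabla_phi U (hor Y) p + eta p (Y p) *: nabla_phi U xi p.
    move=> sU; rewrite {1}(hor_add Y).
    by rewrite (nabla_phiDr oA Ap sU shY (scal _ _ sxi seY)) (nabla_phiZr oA Ap seY sU sxi).
  rewrite {1}(hor_add X) (nabla_phiDl oA Ap shX (scal _ _ sxi seX) sY).
  rewrite (nabla_phiZl oA Ap seX sxi sY) (splitr _ shX) (splitr _ sxi).
  by rewrite [eta p (X p) *: (_ + _)]scalerDr scalerA !addrA.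
have ZE v : g p v (Z p) = g p v (hor Z p) + eta p (Z p) * eta p v.
  by rewrite {1}(hor_add Z) !metric_expand metric_xi.
move: F1 F2 F3 F4 F5 F6 F7 F8.
move: (nabla_phi (hor X) (hor Y) p) (nabla_phi (hor X) xi p)
  (nabla_phi xi (hor Y) p) (nabla_phi xi xi p) => v1 v2 v3 v4.
rewrite !metric_xi => F1 F2 F3 F4 F5 F6 F7 F8.
rewrite !(metricDl (ac_g acc)) !(metricZl (ac_g acc)) (metricNl (ac_g acc)).
rewrite (metricZl (ac_g acc)) metric_xil (ZE v1) (ZE v2) (ZE v3) (ZE v4).
rewrite F1 F2 F3 F4 F5 F6 F7 F8 /hor !metric_expand !metric_xil !metric_xi !(ac_eta_xi acc).
ring.
Qed.

(** For [Y = xi] the formula reads [phi (nabla X xi) = - phi (phi X)]. Applying [phi] determines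
    [nabla X xi] up to its [xi] component, which is zero because [xi] has constant length. *)
Lemma sasaki_nabla_xi A X p : sasaki_formula -> open A -> A p -> smooth_field A X ->
  nabla X xi p = - phi p (X p).
Proof.
move=> H oA Ap sX; have sxi := smooth_xi A.
have := H A X xi p oA Ap sX sxi.
rewrite /nabla_phi (_ : (fun q => phi q (xi q)) = fun=> 0); last first.
  by apply/funext => q; rewrite (ac_phi_xi acc).
rewrite (connection0r oA Ap sX) sub0r metric_xi (ac_eta_xi acc) mulr1 => E.
have {E}E : phi p (nabla X xi p) = - phi p (phi p (X p)).
  rewrite -[LHS]opprK E (ac_phi_phi acc) scale1r.
  by apply/rowP => i; rewrite !mxE; ring.
have := congr1 (phi p) E; rewrite phiN !(ac_phi_phi acc) (ac_eta_phi acc) scale0r addr0 opprK.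
suff -> : eta p (nabla X xi p) = 0 by rewrite scale0r addr0 => <-; rewrite opprK.
have := eta_nabla oA Ap sX sxi.
rewrite (_ : (fun q => eta q (xi q)) = fun=> 1); last first.
  by apply/funext => q; rewrite (ac_eta_xi acc).
by rewrite dfun_cst metric_xil; lra.
Qed.

End Connection.
End AlmostContact.

(** * Metric duality and gradients *)

Section MetricDual.
Variables (R : realType) (m : nat) (M : manifold R m).
Variables (s t : nat) (g : M -> 'rV[R]_m -> 'rV[R]_m -> R).
Hypothesis gP : pseudo_riemannian s t g.

(** In an orthonormal frame the coefficients of the dual vector are the values of [l] on the frame,
    corrected by the signs [e i] of the metric. *)
Lemma metric_dual p (l : 'rV[R]_m -> R) :
  (forall x y, l (x + y) = l x + l y) -> (forall a x, l (a *: x) = a * l x) ->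
  exists U, forall z, g p U z = l z.
Proof.
move=> lD lZ; have [_ [B uB BE]] := metric_signature gP p.
have l0 : l 0 = 0 by apply: (addrI (l 0)); rewrite -lD !addr0.
pose e (i : 'I_m) : R := if (i < s)%N then 1 else -1.
have ee i : e i * e i = 1 by rewrite /e; case: ifP => _; rewrite ?mulrNN mulr1.
exists (\sum_i (e i * l (row i B)) *: row i B) => z.
have zE : z = \sum_i (z *m invmx B) 0 i *: row i B.
  by rewrite -[LHS](mulmxKV uB) mulmx_sum_row.
rewrite [in RHS]zE (big_morph l lD l0) (metric_suml gP); apply: eq_bigr => i _.
rewrite (metricZl gP) (Defs.metric_sym gP) [in LHS]zE (metric_suml gP) (bigD1 i) //= big1.
  rewrite (metricZl gP) BE eqxx addr0 lZ -/(e i).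
  by rewrite -[RHS]mulr1 -(ee i); ring.
by move=> j /negPf ji; rewrite (metricZl gP) BE ji mulr0.
Qed.

(** The dual vectors are chosen pointwise; the resulting field is smooth by [smooth_field_dual], its
    pairings with smooth fields being derivatives of [f]. *)
Lemma gradient (f : M -> R) : smooth_function setT f ->
  exists2 U : vector_field M, smooth_field setT U & forall p z, g p (U p) z = dfun f p z.
Proof.
move=> sf.
have H p : exists U, forall z, g p U z = dfun f p z.
  by apply: metric_dual => *; [exact: dfunD_vec|exact: dfunZ_vec].
have [U UE] := choice H; exists U => //.
apply: (smooth_field_dual gP openT) => A X oA _ sX.
rewrite (_ : (fun q => _) = fun q => dfun f q (X q)); last first.
  by apply/funext => q.
by apply: smooth_function_dfun => //; exact: smooth_function_sub sf.
Qed.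

End MetricDual.

(** * The deformed structure *)

Section Deformation.
Variables (R : realType) (n : nat) (M : manifold R (2 * n).+1).
Local Notation T := 'rV[R]_(2 * n).+1.
Variables (phi : M -> T -> T) (xi : M -> T) (eta : M -> T -> R).
Variable (g : M -> T -> T -> R).
Hypothesis acc : almost_contact_complex_riemannian phi xi eta g.
Variables u v w : M -> R.
Hypotheses (u_smooth : smooth_function setT u) (v_smooth : smooth_function setT v).
Hypothesis w_smooth : smooth_function setT w.

(** The real part of $e^{2(u+iv)}$; [conf_im] is the imaginary part. *)
Definition conf_re p := expR (2 * u p) * cos (2 * v p).
Definition conf_im p := expR (2 * u p) * sin (2 * v p).

Local Notation gb := (g_bar u v w phi eta g).

Lemma g_barE p x y : gb p x y = conf_re p * g p x y +
  conf_im p * g p x (phi p y) + (expR (w p) ^+ 2 - conf_re p) * eta p x * eta p y.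
Proof.
by rewrite /g_bar /conf_re /conf_im (_ : expR (2 * w p) = expR (w p) ^+ 2)
  // mulr_natl mulr2n expRD expr2.
Qed.

Lemma smooth_function_scale (f : M -> R) a : smooth_function setT f ->
  smooth_function setT (fun q => a * f q).
Proof.
by move=> sf; apply: (smooth_functionM openT) => //; exact: smooth_function_cst.
Qed.

Lemma smooth_function_exp_scale (f : M -> R) a : smooth_function setT f ->
  smooth_function setT (fun q => expR (a * f q)).
Proof.
move=> sf.
exact: (smooth_function_comp openT (@smooth_expR R) (smooth_function_scale a sf)).
Qed.

Lemma smooth_conf_re : smooth_function setT conf_re.
Proof.
exact: (smooth_functionM openT (smooth_function_exp_scale 2 u_smooth)
  (smooth_function_comp openT (@smooth_cos R) (smooth_function_scale 2 v_smooth))).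
Qed.

Lemma smooth_conf_im : smooth_function setT conf_im.
Proof.
exact: (smooth_functionM openT (smooth_function_exp_scale 2 u_smooth)
  (smooth_function_comp openT (@smooth_sin R) (smooth_function_scale 2 v_smooth))).
Qed.

Lemma dfun_scale (f : M -> R) a p x : smooth_function setT f ->
  dfun (fun q => a * f q) p x = a * dfun f p x.
Proof.
move=> sf; rewrite (dfunM I x (smooth_function_cst setT a) sf).
by rewrite dfun_cst mul0r addr0.
Qed.

Lemma dfun_exp_scale (f : M -> R) a p x : smooth_function setT f ->
  dfun (fun q => expR (a * f q)) p x = a * expR (a * f p) * dfun f p x.
Proof.
move=> sf; have saf := smooth_function_scale a sf.
apply: (etrans (dfun_comp (k := expR) I x saf (is_derive_expR _))).
by rewrite dfun_scale //; ring.
Qed.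

Lemma dfun_conf_re p x :
  dfun conf_re p x = 2 * (conf_re p * dfun u p x - conf_im p * dfun v p x).
Proof.
have s2v := smooth_function_scale 2 v_smooth.
have s2u := smooth_function_exp_scale 2 u_smooth.
have sk := smooth_function_comp openT (@smooth_cos R) s2v.
have kE : dfun (fun q => cos (2 * v q)) p x = - sin (2 * v p) * (2 * dfun v p x).
  rewrite -dfun_scale //.
  exact: (dfun_comp (k := cos) I x s2v (is_derive_cos _)).
apply: (etrans (dfunM I x s2u sk)).
rewrite kE dfun_exp_scale // /conf_re /conf_im.
move: (expR _) (cos _) (sin _) (dfun u p x) (dfun v p x) => e c s du dv; ring.
Qed.

Lemma dfun_conf_im p x :
  dfun conf_im p x = 2 * (conf_im p * dfun u p x + conf_re p * dfun v p x).
Proof.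
have s2v := smooth_function_scale 2 v_smooth.
have s2u := smooth_function_exp_scale 2 u_smooth.
have sk := smooth_function_comp openT (@smooth_sin R) s2v.
have kE : dfun (fun q => sin (2 * v q)) p x = cos (2 * v p) * (2 * dfun v p x).
  rewrite -dfun_scale //.
  exact: (dfun_comp (k := sin) I x s2v (is_derive_sin _)).
apply: (etrans (dfunM I x s2u sk)).
rewrite kE dfun_exp_scale // /conf_re /conf_im.
move: (expR _) (cos _) (sin _) (dfun u p x) (dfun v p x) => e c s du dv; ring.
Qed.

Lemma conf_neq0 p : conf_re p ^+ 2 + conf_im p ^+ 2 != 0.
Proof.
rewrite /conf_re /conf_im !exprMn -mulrDr cos2Dsin2 mulr1.
by rewrite expf_neq0 // gt_eqF // expR_gt0.
Qed.

(* On ker eta the metric gb is the real part of k ^ 2 times the complex bilinear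
   extension of g, with k = exp (u + i v); this map is multiplication by k ^ -1
   there, so it pulls gb back to g. *)
Definition conf_inv p x : T :=
  (expR (- u p) * cos (v p)) *: (x - eta p x *: xi p)
  - (expR (- u p) * sin (v p)) *: phi p x + (expR (- w p) * eta p x) *: xi p.

Lemma conf_inv_linear p : linear (conf_inv p).
Proof.
move=> a x y; rewrite /conf_inv (eta_linear acc) (phi_linear acc).
by apply/rowP => i; rewrite !mxE; ring.
Qed.

Lemma g_bar_conf_inv p x y : gb p (conf_inv p x) (conf_inv p y) = g p x y.
Proof.
have me := metric_expand acc.
rewrite g_barE /conf_inv.
rewrite !(phiD acc, phiN acc, phiZ acc, etaD acc, etaN acc, etaZ acc).
rewrite !(ac_phi_phi acc) !(ac_phi_xi acc) !(ac_eta_phi acc) !(ac_eta_xi acc).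
rewrite !me !(metric_phiC acc) !(ac_phi_phi acc) !(ac_phi_xi acc).
rewrite !me !(metric_xi acc) !(metric_xil acc) !(ac_eta_phi acc) !(ac_eta_xi acc).
rewrite !(eta0 acc, phi0 acc) !(Defs.metric_sym (ac_g acc) p _ 0) !(metric0l (ac_g acc)).
rewrite /conf_re /conf_im !(mulr_natl _ 2) !mulr2n expRD cosD sinD !expRN.
have := cos2Dsin2 (v p).
have : expR (u p) != 0 by rewrite gt_eqF ?expR_gt0.
have : expR (w p) != 0 by rewrite gt_eqF ?expR_gt0.
move: (expR (u p)) (expR (w p)) (cos (v p)) (sin (v p)) => U W c s W0 U0 cs.
move: (g p x y) (g p x (phi p y)) (eta p x) (eta p y) => G Q ex ey.
(* The exponentials of [u] and [w] cancel, and the product of the factors $e^{2iv}$ and $e^{-2iv}$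
   leaves $(c^2+s^2)^2$ on [ker eta]. *)
rewrite [LHS](_ : _ = (c ^+ 2 + s ^+ 2) ^+ 2 * (G - ex * ey) + ex * ey).
  by rewrite cs expr1n mul1r subrK.
by field; rewrite U0 W0.
Qed.

Lemma g_bar_sym p x y : gb p x y = gb p y x.
Proof.
rewrite !g_barE (Defs.metric_sym (ac_g acc) p y x).
rewrite (Defs.metric_sym (ac_g acc) p y (phi p x)) (metric_phiC acc).
by rewrite -!mulrA (mulrC (eta p y)).
Qed.

Lemma g_bar_linear p a x y z : gb p (a *: x + y) z = a * gb p x z + gb p y z.
Proof.
rewrite !g_barE (eta_linear acc) !(metric_linear (ac_g acc)).
move: (g p x z) (g p y z) (g p x _) (g p y _) (eta p _) (eta p y) (eta p z) => *.
by move: (conf_re p) (conf_im p) => *; ring.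
Qed.

Lemma smooth_g_bar A X Y : open A -> smooth_field A X -> smooth_field A Y ->
  smooth_function A (fun p => gb p (X p) (Y p)).
Proof.
move=> oA sX sY.
have sub f : smooth_function setT f -> smooth_function A f.
  by apply: smooth_function_sub; exact: subsetT.
have sa := sub _ smooth_conf_re; have sb := sub _ smooth_conf_im.
have sw := sub _ (smooth_function_exp_scale 2 w_smooth).
have sp := smooth_phi acc oA sY.
have ex := smooth_eta acc oA sX; have ey := smooth_eta acc oA sY.
have s1 := smooth_functionM oA sa (smooth_metric acc oA sX sY).
have s2 := smooth_functionM oA sb (smooth_metric acc oA sX sp).
have s3 := smooth_functionM oA (smooth_functionM oA (smooth_functionB oA sw sa) ex) ey.
exact: (smooth_functionD oA (smooth_functionD oA s1 s2) s3).
Qed.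

Lemma g_bar_pseudo_riemannian : pseudo_riemannian n.+1 n gb.
Proof.
split; [exact: g_bar_linear|exact: g_bar_sym|exact: smooth_g_bar|move=> p].
have [st [B uB BE]] := metric_signature (ac_g acc) p; split=> //.
pose S : {linear T -> T} :=
  HB.pack (conf_inv p) (GRing.isLinear.Build _ _ _ _ _ (conf_inv_linear p)).
(* [conf_inv] sends an orthonormal frame of [g] to one of [gb] with the same signs. It is injective:
   if [S x = 0], then [g x z = gb (S x) (S z) = 0] for all [z]. *)
pose C : 'M[R]_((2 * n).+1) := \matrix_i S (row i B).
have CE i : row i C = S (row i B) by rewrite rowK.
exists C; last by move=> i j; rewrite !CE g_bar_conf_inv BE.
rewrite -row_free_unit -kermx_eq0; apply/eqP/row_matrixP => i; rewrite row0.
set r := row i _; have r0 : r *m C = 0 by rewrite /r -row_mul mulmx_ker row0.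
suff rB : r *m B = 0 by rewrite -(mulmxK uB r) rB mul0mx.
apply: (metric_nondegenerate (ac_g acc) (p := p)) => z.
have S0 : S (r *m B) = 0.
  rewrite -r0 !mulmx_sum_row linear_sum; apply: eq_bigr => k _.
  by rewrite linearZ CE.
have {}S0 : conf_inv p (r *m B) = 0 by [].
rewrite -g_bar_conf_inv S0 g_barE (eta0 acc) !(metric0l (ac_g acc)).
by rewrite !mulr0 !mul0r !addr0.
Qed.

Lemma g_bar_almost_contact :
  almost_contact_complex_riemannian phi (xi_bar w xi) (eta_bar w eta) gb.
Proof.
have EE p : expR (w p) * expR (- w p) = 1 by rewrite -expRD subrr expR0.
have sEN : smooth_function setT (fun p => expR (- w p)).
  exact: (smooth_function_comp openT (@smooth_expR R) (smooth_functionN openT w_smooth)).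
have sE : smooth_function setT (fun p => expR (w p)).
  exact: (smooth_function_comp openT (@smooth_expR R) w_smooth).
split.
- exact: ac_phi acc.
- exact: (smooth_fieldZ openT sEN (ac_xi acc)).
- split=> [p a x y|A X oA sX].
    by rewrite /eta_bar (eta_linear acc); ring.
  apply: (smooth_functionM oA _ (smooth_eta acc oA sX)).
  by apply: smooth_function_sub sE; exact: subsetT.
- exact: g_bar_pseudo_riemannian.
- by move=> p; rewrite /xi_bar (phiZ acc) (ac_phi_xi acc) scaler0.
- move=> p x; rewrite (ac_phi_phi acc) /eta_bar /xi_bar scalerA.
  by rewrite mulrAC EE mul1r.
- by move=> p x; rewrite /eta_bar (ac_eta_phi acc) mulr0.
- by move=> p; rewrite /eta_bar /xi_bar (etaZ acc) (ac_eta_xi acc) mulr1 EE.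
- move=> p x y; rewrite !g_barE /eta_bar !(ac_eta_phi acc) !(ac_g_phi acc).
  rewrite (ac_eta_phi acc) expr2.
  move: (conf_re p) (conf_im p) (expR (w p)) => a b W.
  by move: (g p x y) (g p x (phi p y)) (eta p x) (eta p y) => *; ring.
Qed.

End Deformation.

(** * The covariant derivative of the deformed metric *)

Section DeformedMetric.
Variables (R : realType) (n : nat) (M : manifold R (2 * n).+1).
Local Notation T := 'rV[R]_(2 * n).+1.
Variables (phi : M -> T -> T) (xi : M -> T) (eta : M -> T -> R).
Variable (g : M -> T -> T -> R).
Hypothesis acc : almost_contact_complex_riemannian phi xi eta g.
Variables u v w : M -> R.
Hypotheses (u_smooth : smooth_function setT u) (v_smooth : smooth_function setT v).
Hypothesis w_smooth : smooth_function setT w.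
Variable nabla : vector_field M -> vector_field M -> vector_field M.
Hypothesis lc : levi_civita g nabla.
Hypothesis nabla_sasaki : sasaki_formula phi xi eta g nabla.

Local Notation gb := (g_bar u v w phi eta g).
Local Notation a := (conf_re u v).
Local Notation b := (conf_im u v).

Let sub_smooth (A : set M) (f : M -> R) : smooth_function setT f -> smooth_function A f.
Proof. by apply: smooth_function_sub; exact: subsetT. Qed.

(* (nabla_x gb)(y, z) *)
Definition nabla_g_bar p x y z : R :=
  dfun a p x * g p y z + dfun b p x * g p y (phi p z)
  + b p * (- (g p x z * eta p y) - g p x y * eta p z + 2 * eta p x * eta p y * eta p z)
  + (2 * expR (w p) ^+ 2 * dfun w p x - dfun a p x) * eta p y * eta p z
  - (expR (w p) ^+ 2 - a p) * (g p y (phi p x) * eta p z + g p z (phi p x) * eta p y).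

Section Local.
Variables (A : set M) (p : M) (X Y Z : vector_field M).
Hypotheses (oA : open A) (Ap : A p) (sX : smooth_field A X).
Hypotheses (sY : smooth_field A Y) (sZ : smooth_field A Z).

Lemma dfun_eta V : smooth_field A V -> dfun (fun q => eta q (V q)) p (X p) =
  eta p (nabla X V p) - g p (V p) (phi p (X p)).
Proof.
move=> sV; rewrite (eta_nabla acc lc oA Ap sX sV).
by rewrite (sasaki_nabla_xi acc lc nabla_sasaki oA Ap sX) (metricNr (ac_g acc)).
Qed.

(** Leibniz rule. Besides the derivatives of the coefficients, [nabla_g_bar] collects what comes
    from [phi] and [eta] not being parallel, given by [nabla_sasaki] and [dfun_eta]. *)
Lemma dfun_g_bar : dfun (fun q => gb q (Y q) (Z q)) p (X p) =
  gb p (nabla X Y p) (Z p) + gb p (Y p) (nabla X Z p)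
  + nabla_g_bar p (X p) (Y p) (Z p).
Proof.
have [_ _ mc] := lc.
have sa := sub_smooth A (smooth_conf_re u_smooth v_smooth).
have sb := sub_smooth A (smooth_conf_im u_smooth v_smooth).
have sw2 : smooth_function A (fun q => expR (w q) * expR (w q)).
  have sw := smooth_function_comp oA (@smooth_expR R) (sub_smooth A w_smooth).
  exact: (smooth_functionM oA sw sw).
have sp := smooth_phi acc oA sZ.
have ey := smooth_eta acc oA sY; have ez := smooth_eta acc oA sZ.
have g1 := smooth_metric acc oA sY sZ; have g2 := smooth_metric acc oA sY sp.
have sc := smooth_functionB oA sw2 sa.
have s1 := smooth_functionM oA sa g1; have s2 := smooth_functionM oA sb g2.
have s31 := smooth_functionM oA sc ey.
have s3 := smooth_functionM oA s31 ez.
have -> : (fun q => gb q (Y q) (Z q)) = fun q =>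
    a q * g q (Y q) (Z q) + b q * g q (Y q) (phi q (Z q)) +
    (expR (w q) * expR (w q) - a q) * eta q (Y q) * eta q (Z q).
  by apply/funext => q; rewrite g_barE expr2.
have dw : dfun (fun q => expR (w q) * expR (w q)) p (X p) =
    2 * expR (w p) ^+ 2 * dfun w p (X p).
  have sw := smooth_function_comp oA (@smooth_expR R) (sub_smooth A w_smooth).
  rewrite (dfunM Ap _ sw sw).
  rewrite (dfun_comp (k := expR) Ap (X p) (sub_smooth A w_smooth) (is_derive_expR _)).
  by move: (expR _) (dfun _ _ _) => *; ring.
rewrite (dfunD Ap _ (smooth_functionD oA s1 s2) s3) (dfunD Ap _ s1 s2).
rewrite (dfunM Ap _ sa g1) (dfunM Ap _ sb g2) (dfunM Ap _ s31 ez) (dfunM Ap _ sc ey).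
rewrite (dfunB oA Ap _ sw2 sa) dw !dfun_eta //.
rewrite (mc _ _ _ _ _ oA Ap sX sY sZ) (mc _ _ _ _ _ oA Ap sX sY sp).
have := nabla_sasaki oA Ap sX sZ; rewrite /nabla_phi => /(canRL (subrK _)) ->.
rewrite !g_barE !(metric_expand acc) !(metric_xi acc) (Defs.metric_sym (ac_g acc) p (Y p) (X p)).
rewrite /nabla_g_bar expr2.
move: (nabla X Y p) (nabla X Z p) => y' z'.
move: (dfun a p (X p)) (dfun b p (X p)) (dfun w p (X p)) (a p) (b p) (expR (w p)).
move=> da db dw' a0 b0 W.
move: (X p) (Y p) (Z p) => x y z.
move: (g p x y) (g p x z) (g p y z) (g p y' z) (g p y z') (g p y (phi p z))
  (g p y (phi p z')) (g p y' (phi p z)) (g p y (phi p x)) (g p z (phi p x))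
  (eta p x) (eta p y) (eta p z) (eta p y') (eta p z').
by move=> *; ring.
Qed.

End Local.
End DeformedMetric.

(** * Sufficiency of the equations *)

Section Sufficiency.
Variables (R : realType) (n : nat) (M : manifold R (2 * n).+1).
Local Notation T := 'rV[R]_(2 * n).+1.
Variables (phi : M -> T -> T) (xi : M -> T) (eta : M -> T -> R).
Variable (g : M -> T -> T -> R).
Hypothesis acc : almost_contact_complex_riemannian phi xi eta g.
Variables u v w : M -> R.
Hypotheses (u_smooth : smooth_function setT u) (v_smooth : smooth_function setT v).
Hypothesis w_smooth : smooth_function setT w.
Variable nabla : vector_field M -> vector_field M -> vector_field M.
Hypothesis lc : levi_civita g nabla.
Hypothesis nabla_sasaki : sasaki_formula phi xi eta g nabla.

Local Notation gb := (g_bar u v w phi eta g).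
Local Notation a := (conf_re u v).
Local Notation b := (conf_im u v).

Hypothesis dw_phi : forall p x, dfun w p (phi p x) = 0.
Hypothesis dv_phi : forall p x, dfun v p (phi p x) = dfun u p x.
Hypothesis du_phi : forall p x,
  dfun u p (phi p x) = (1 - expR (w p)) * eta p x - dfun v p x.

Variable U : vector_field M.
Hypotheses (U_smooth : smooth_field setT U) (UE : forall p z, g p (U p) z = dfun u p z).

Lemma du_xi p : dfun u p (xi p) = 0.
Proof. by rewrite -dv_phi (ac_phi_xi acc) /dfun linear0. Qed.

(** Evaluate [dw o phi = 0] at [phi x] and use the formula for [phi (phi x)]. *)
Lemma dw_eta p x : dfun w p x = dfun w p (xi p) * eta p x.
Proof.
have := dw_phi p (phi p x); rewrite (ac_phi_phi acc) dfunD_vec dfunZ_vec.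
by rewrite -scaleN1r dfunZ_vec; lra.
Qed.

Lemma eta_U p : eta p (U p) = 0.
Proof. by rewrite -(metric_xi acc) UE du_xi. Qed.

(* On ker eta this is the usual conformal change of the Levi-Civita connection
   for the complex metric g - i g(., phi .) and the complex function u + i v;
   the xi components are those imposed by the Sasaki-like condition. *)
Definition conf_tensor p x y : T :=
  dfun u p x *: (y - eta p y *: xi p) + dfun u p y *: (x - eta p x *: xi p)
  + dfun v p x *: phi p y + dfun v p y *: phi p x
  - (g p x y - eta p x * eta p y) *: U p + g p x (phi p y) *: phi p (U p)
  + (- g p x (phi p y)
     + expR (- w p) * (a p * g p x (phi p y) - b p * (g p x y - eta p x * eta p y))
     + dfun w p (xi p) * eta p x * eta p y) *: xi p.

(** This symmetry keeps the torsion zero, and transfers linearity from the second argument to the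
    first. *)
Lemma conf_tensor_sym p x y : conf_tensor p x y = conf_tensor p y x.
Proof.
rewrite /conf_tensor (Defs.metric_sym (ac_g acc) p y x).
rewrite (Defs.metric_sym (ac_g acc) p y (phi p x)) (metric_phiC acc).
apply/rowP => i; rewrite !mxE.
move: (dfun u p x) (dfun v p x) (dfun u p y) (dfun v p y) (dfun w p (xi p)) => *.
move: (eta p x) (eta p y) (g p x y) (g p x (phi p y)) (a p) (b p) (expR _) => *; ring.
Qed.

Lemma conf_tensorDr p x y y' :
  conf_tensor p x (y + y') = conf_tensor p x y + conf_tensor p x y'.
Proof.
rewrite /conf_tensor !(phiD acc, etaD acc, metricDr (ac_g acc), dfunD_vec).
apply/rowP => i; rewrite !mxE.
move: (dfun u p x) (dfun v p x) (dfun u p y) (dfun v p y) (dfun u p y') (dfun v p y')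
  (dfun w p (xi p)) => *.
move: (eta p x) (eta p y) (eta p y') (g p x y) (g p x y') (g p x (phi p y))
  (g p x (phi p y')) (a p) (b p) (expR _) => *; ring.
Qed.

Lemma conf_tensorZr p x c y : conf_tensor p x (c *: y) = c *: conf_tensor p x y.
Proof.
rewrite /conf_tensor !(phiZ acc, etaZ acc, metricZr (ac_g acc), dfunZ_vec).
apply/rowP => i; rewrite !mxE.
move: (dfun u p x) (dfun v p x) (dfun u p y) (dfun v p y) (dfun w p (xi p)) => *.
move: (eta p x) (eta p y) (g p x y) (g p x (phi p y)) (a p) (b p) (expR _) => *; ring.
Qed.

Lemma conf_tensorDl p x x' y :
  conf_tensor p (x + x') y = conf_tensor p x y + conf_tensor p x' y.
Proof. by rewrite !(conf_tensor_sym p _ y) conf_tensorDr. Qed.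

Lemma conf_tensorZl p c x y : conf_tensor p (c *: x) y = c *: conf_tensor p x y.
Proof. by rewrite !(conf_tensor_sym p _ y) conf_tensorZr. Qed.

Lemma smooth_conf_tensor A X Y : open A -> smooth_field A X -> smooth_field A Y ->
  smooth_field A (fun p => conf_tensor p (X p) (Y p)).
Proof.
move=> oA sX sY.
have sub (f : M -> R) : smooth_function setT f -> smooth_function A f.
  by apply: smooth_function_sub; exact: subsetT.
have sxi := smooth_xi acc A.
have sU : smooth_field A U by apply: smooth_field_sub U_smooth; exact: subsetT.
have sUp := smooth_phi acc oA sU.
have [ex ey] := (smooth_eta acc oA sX, smooth_eta acc oA sY).
have [px py] := (smooth_phi acc oA sX, smooth_phi acc oA sY).
have gxy := smooth_metric acc oA sX sY.
have gxpy := smooth_metric acc oA sX py.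
have [su sv] := (sub _ u_smooth, sub _ v_smooth).
have sa := sub _ (smooth_conf_re u_smooth v_smooth).
have sb := sub _ (smooth_conf_im u_smooth v_smooth).
have sW : smooth_function A (fun q => expR (- w q)).
  apply: (smooth_function_comp oA (@smooth_expR R)); apply: (smooth_functionN oA).
  exact: sub.
have D f V : smooth_function A f -> smooth_field A V ->
  smooth_function A (fun q => dfun f q (V q)) := fun sf sV => smooth_function_dfun oA sf sV.
have h V : smooth_field A V -> smooth_field A (fun q => V q - eta q (V q) *: xi q).
  move=> sV.
  exact: (smooth_fieldB oA sV (smooth_fieldZ oA (smooth_eta acc oA sV) sxi)).
have Z := fun f V sf sV => @smooth_fieldZ _ _ _ A oA f V sf sV.
have Mu := fun f k sf sk => @smooth_functionM _ _ _ A oA f k sf sk.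
have gh := smooth_functionB oA gxy (Mu _ _ ex ey).
have s1 := Z _ _ (D _ _ su sX) (h _ sY).
have s2 := Z _ _ (D _ _ su sY) (h _ sX).
have s3 := Z _ _ (D _ _ sv sX) py.
have s4 := Z _ _ (D _ _ sv sY) px.
have s5 := Z _ _ gh sU.
have s6 := Z _ _ gxpy sUp.
have t1 := smooth_functionB oA (Mu _ _ sa gxpy) (Mu _ _ sb gh).
have t2 := smooth_functionD oA (smooth_functionN oA gxpy) (Mu _ _ sW t1).
have t3 := Mu _ _ (Mu _ _ (D _ _ (sub _ w_smooth) sxi) ex) ey.
have s7 := Z _ _ (smooth_functionD oA t2 t3) sxi.
exact: (smooth_fieldD oA (smooth_fieldD oA (smooth_fieldB oA (smooth_fieldD oA
  (smooth_fieldD oA (smooth_fieldD oA s1 s2) s3) s4) s5) s6) s7).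
Qed.

Definition nabla_bar X Y : vector_field M :=
  fun p => nabla X Y p + conf_tensor p (X p) (Y p).

Lemma nabla_bar_connection : connection nabla_bar.
Proof.
have [cn _ _] := lc; split.
- move=> A X Y oA sX sY.
  exact: (smooth_fieldD oA (connection_smooth cn oA sX sY) (smooth_conf_tensor oA sX sY)).
- move=> A X X' Y p oA Ap sX sX' sY; rewrite /nabla_bar (connectionDl cn oA Ap sX sX' sY).
  by rewrite conf_tensorDl [LHS]addrACA.
- move=> A f X Y p oA Ap sf sX sY; rewrite /nabla_bar (connectionZl cn oA Ap sf sX sY).
  by rewrite conf_tensorZl [RHS]scalerDr.
- move=> A X Y Y' p oA Ap sX sY sY'; rewrite /nabla_bar (connectionDr cn oA Ap sX sY sY').
  by rewrite conf_tensorDr [LHS]addrACA.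
- move=> A f X Y p oA Ap sf sX sY; rewrite /nabla_bar (connectionZr cn oA Ap sf sX sY).
  by rewrite conf_tensorZr [in RHS]scalerDr [RHS]addrA.
Qed.

Lemma nabla_bar_torsion_free : torsion_free nabla_bar.
Proof.
have [_ tf _] := lc; move=> A X Y f p oA Ap sX sY sf.
rewrite -(tf A X Y f p oA Ap sX sY sf) /nabla_bar (conf_tensor_sym p (Y p)).
by rewrite opprD addrACA subrr addr0.
Qed.

(** Tensor form of the compatibility of [nabla_bar] with [gb]. Once the equations on [u], [v], [w]
    eliminate the derivatives along [phi] and reduce [dw] to a multiple of [eta], it is an identity
    of rational expressions in the remaining scalars. *)
Lemma g_bar_conf_tensor p x y z :
  gb p (conf_tensor p x y) z + gb p y (conf_tensor p x z) =
  nabla_g_bar phi eta g u v w p x y z.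
Proof.
have EE := expRN (w p); have W0 : expR (w p) != 0 by rewrite gt_eqF ?expR_gt0.
rewrite (g_bar_sym acc u v w p y) !g_barE /conf_tensor.
rewrite !(metric_expand acc) !(etaD acc, etaN acc, etaZ acc).
rewrite !(metric_phiC acc) !(ac_phi_phi acc) !(metric_expand acc) !UE.
rewrite !(metric_xi acc) !(metric_xil acc) !(ac_eta_phi acc) !(ac_eta_xi acc) !du_phi !eta_U.
rewrite /nabla_g_bar dfun_conf_re // dfun_conf_im // (dw_eta p x) EE.
rewrite (Defs.metric_sym (ac_g acc) p z y).
rewrite (Defs.metric_sym (ac_g acc) p z (phi p y)) (metric_phiC acc).
rewrite (Defs.metric_sym (ac_g acc) p z (phi p x)) (metric_phiC acc).
rewrite (Defs.metric_sym (ac_g acc) p y (phi p x)) (metric_phiC acc).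
rewrite !du_xi.
move: (dfun w p (xi p)) (expR (w p)) W0 (a p) (b p) => dw W W0 A B.
move: (g p x y) (g p x z) (g p y z) (g p x (phi p y)) (g p x (phi p z))
  (g p y (phi p z)) => *.
move: (dfun u p x) (dfun u p y) (dfun u p z) (dfun v p x) (dfun v p y) (dfun v p z)
  (eta p x) (eta p y) (eta p z) => *.
by field.
Qed.

Lemma nabla_bar_metric : metric_compatible gb nabla_bar.
Proof.
move=> A X Y Z p oA Ap sX sY sZ.
rewrite (dfun_g_bar acc u_smooth v_smooth w_smooth lc nabla_sasaki oA Ap sX sY sZ).
rewrite -g_bar_conf_tensor /nabla_bar.
have gP := g_bar_pseudo_riemannian acc u_smooth v_smooth w_smooth.
by rewrite (metricDl gP) (metricDr gP) addrACA.
Qed.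

(** Passing from [nabla] to [nabla_bar] changes the derivative of [phi] by [conf_tensor x (phi y) -
    phi (conf_tensor x y)], which is compared with the change of the right-hand side. *)
Lemma nabla_bar_sasaki : sasaki_formula phi (xi_bar w xi) (eta_bar w eta) gb nabla_bar.
Proof.
move=> A X Y p oA Ap sX sY.
have := nabla_sasaki oA Ap sX sY.
rewrite /nabla_phi /nabla_bar (phiD acc) opprD addrACA => ->.
have EE := expRN (w p); have W0 : expR (w p) != 0 by rewrite gt_eqF ?expR_gt0.
move: (X p) (Y p) => x y.
rewrite /xi_bar /eta_bar g_barE /conf_tensor.
rewrite !(phiD acc, phiN acc, phiZ acc) !(ac_phi_phi acc) !(ac_phi_xi acc).
rewrite !(metric_expand acc) !(ac_eta_phi acc) !du_phi !dv_phi eta_U (metric_xi acc) EE.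
apply/rowP => i; rewrite !mxE.
move: (dfun w p (xi p)) (expR (w p)) W0 (a p) (b p) => dw W W0 A' B.
move: (g p x y) (g p x (phi p y)) (dfun u p x) (dfun u p y) (dfun v p x) (dfun v p y) => *.
move: (eta p x) (eta p y) => *.
by field.
Qed.

End Sufficiency.

(** * Necessity of the equations *)

Section Necessity.
Variables (R : realType) (n : nat) (M : manifold R (2 * n).+1).
Local Notation T := 'rV[R]_(2 * n).+1.
Variables (phi : M -> T -> T) (xi : M -> T) (eta : M -> T -> R).
Variable (g : M -> T -> T -> R).
Hypothesis acc : almost_contact_complex_riemannian phi xi eta g.
Variables u v w : M -> R.
Hypotheses (u_smooth : smooth_function setT u) (v_smooth : smooth_function setT v).
Hypothesis w_smooth : smooth_function setT w.
Variable nabla : vector_field M -> vector_field M -> vector_field M.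
Hypothesis lc : levi_civita g nabla.
Hypothesis nabla_sasaki : sasaki_formula phi xi eta g nabla.

Local Notation gb := (g_bar u v w phi eta g).
Local Notation a := (conf_re u v).
Local Notation b := (conf_im u v).

Variable nablab : vector_field M -> vector_field M -> vector_field M.
Hypothesis lcb : levi_civita gb nablab.
Hypothesis nablab_sasaki :
  sasaki_formula phi (xi_bar w xi) (eta_bar w eta) gb nablab.

Local Notation N := (nabla_g_bar phi eta g u v w).

Let accb : almost_contact_complex_riemannian phi (xi_bar w xi) (eta_bar w eta) gb :=
  g_bar_almost_contact acc u_smooth v_smooth w_smooth.
Let gbP : pseudo_riemannian n.+1 n gb := ac_g accb.

Definition conn_diff X Y : vector_field M := fun p => nablab X Y p - nabla X Y p.

Section Local.
Variables (A : set M) (p : M).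
Hypotheses (oA : open A) (Ap : A p).
Implicit Types X Y Z : vector_field M.

(** Both connections are torsion free, so their antisymmetric parts are the same Lie bracket. *)
Lemma conn_diff_sym X Y : smooth_field A X -> smooth_field A Y ->
  conn_diff X Y p = conn_diff Y X p.
Proof.
move=> sX sY; have [_ tf _] := lc; have [_ tfb _] := lcb.
suff H : nablab X Y p - nablab Y X p = nabla X Y p - nabla Y X p.
  rewrite /conn_diff; apply/eqP; rewrite -subr_eq0; apply/eqP.
  move: H; move: (nablab X Y p) (nablab Y X p) (nabla X Y p) (nabla Y X p) => x1 x2 y1 y2 H.
  by rewrite opprB addrA addrAC (addrAC x1) H; apply/rowP => i; rewrite !mxE; ring.
apply: (dfun_inj (p := p)) => B f oB Bp sf.
pose C := A `&` B.
have oC : open C by exact: openI.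
have [CA CB] : C `<=` A /\ C `<=` B by split=> q [].
have sX' := smooth_field_sub CA sX; have sY' := smooth_field_sub CA sY.
have sf' := smooth_function_sub CB sf.
by rewrite (tf C X Y f p oC (conj Ap Bp) sX' sY' sf') (tfb C X Y f p oC (conj Ap Bp) sX' sY' sf').
Qed.

(* The coefficient c is irrelevant: gb (xi, z) = 0 for z in ker eta. *)
Lemma conn_diff_phi X Y : smooth_field A X -> smooth_field A Y ->
  eta p (X p) = 0 \/ eta p (Y p) = 0 ->
  exists c, conn_diff X (fun q => phi q (Y q)) p =
    phi p (conn_diff X Y p) + ((1 - expR (w p)) * eta p (Y p)) *: X p + c *: xi p.
Proof.
move=> sX sY e0.
have := nabla_sasaki oA Ap sX sY; have := nablab_sasaki oA Ap sX sY.
rewrite /nabla_phi => /(canRL (subrK _)) E1 /(canRL (subrK _)) E2.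
rewrite /conn_diff E1 E2 (phiD acc) (phiN acc) /xi_bar /eta_bar.
(* Difference of the [xi] coefficients of the two formulas; [e0] removes the terms in
   [eta X * eta Y]. *)
exists (- gb p (X p) (Y p) * expR (- w p) + g p (X p) (Y p)).
apply/rowP => i; rewrite !mxE; case: e0 => ->; ring.
Qed.

(** Both structures satisfy [sasaki_nabla_xi] with the same [phi]; expanding
    [nablab X (expR (- w) *: xi)] by Leibniz and solving gives [nablab X xi]. *)
Lemma conn_diff_xi X : smooth_field A X -> conn_diff X xi p =
  (1 - expR (w p)) *: phi p (X p) + dfun w p (X p) *: xi p.
Proof.
move=> sX; have sxi := smooth_xi acc A.
have sw : smooth_function A w by apply: smooth_function_sub w_smooth; exact: subsetT.
have sW := smooth_function_comp oA (@smooth_expR R) (smooth_functionN oA sw).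
have [cnb _ _] := lcb.
rewrite /conn_diff (sasaki_nabla_xi acc lc nabla_sasaki oA Ap sX) opprK.
have := sasaki_nabla_xi accb lcb nablab_sasaki oA Ap sX.
rewrite (connectionZr cnb oA Ap sW sX sxi).
rewrite (dfun_comp (k := expR) Ap (X p) (smooth_functionN oA sw) (is_derive_expR _)).
rewrite (dfunN Ap _ sw) => /(canRL (addKr _)) E.
have -> : nablab X xi p = expR (w p) *: (expR (- w p) *: nablab X xi p).
  by rewrite scalerA -expRD subrr expR0 scale1r.
rewrite E; have EE : expR (w p) * expR (- w p) = 1 by rewrite -expRD subrr expR0.
apply/rowP => i; rewrite !mxE.
rewrite [X in X + _ = _](_ : _ = (expR (w p) * expR (- w p)) * dfun w p (X p) * xi p 0 i
   - expR (w p) * phi p (X p) 0 i); last by ring.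
by rewrite EE; ring.
Qed.

Lemma conn_diff_metric X Y Z : smooth_field A X -> smooth_field A Y -> smooth_field A Z ->
  gb p (conn_diff X Y p) (Z p) + gb p (Y p) (conn_diff X Z p) = N p (X p) (Y p) (Z p).
Proof.
move=> sX sY sZ; have [_ _ mcb] := lcb.
have := mcb A X Y Z p oA Ap sX sY sZ.
rewrite (dfun_g_bar acc u_smooth v_smooth w_smooth lc nabla_sasaki oA Ap sX sY sZ).
rewrite /conn_diff !(metricDl gbP, metricDr gbP, metricNl gbP, metricNr gbP).
by move=> H; lra.
Qed.

End Local.

Let ext p x : exists2 X : vector_field M, smooth_field (cdom (chart_at p)) X & X p = x :=
  field_extension p x.

Let ext_hor p x : eta p x = 0 ->
  exists2 X : vector_field M, in_H eta (cdom (chart_at p)) X & X p = x.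
Proof.
have [X sX Xx] := ext p x; move=> ex; exists (hor xi eta X).
  by apply: (hor_in_H acc) => //; exact: cdom_open.
by rewrite /hor Xx ex scale0r subr0.
Qed.

Lemma gb_xi p x : gb p x (xi p) = expR (w p) ^+ 2 * eta p x.
Proof.
rewrite g_barE (metric_xi acc) (ac_phi_xi acc) (ac_eta_xi acc).
rewrite (Defs.metric_sym (ac_g acc)) (metric0l (ac_g acc)); ring.
Qed.

(** Taking [Z = xi] in [conn_diff_metric] computes [eta (conn_diff X Y)]. It is symmetric in [X] and
    [Y], and the only term that is not visibly symmetric is [dw(X) * eta Y]. *)
Lemma dw_eta_sym p x y : dfun w p x * eta p y = dfun w p y * eta p x.
Proof.
have oA := cdom_open (chart_at p); have Ap := chart_at_dom p.
have [X sX <-] := ext p x; have [Y sY <-] := ext p y.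
have sxi := smooth_xi acc (cdom (chart_at p)).
have H1 := conn_diff_metric oA Ap sX sY sxi.
have H2 := conn_diff_metric oA Ap sY sX sxi.
move: H1 H2; rewrite (conn_diff_sym oA Ap sY sX) !(conn_diff_xi oA Ap) //.
rewrite !(metricDr gbP, metricZr gbP) !gb_xi.
rewrite /nabla_g_bar !(ac_phi_xi acc) !(metric_xi acc) !(metric_xil acc) (ac_eta_xi acc).
rewrite !(ac_eta_phi acc) !g_barE !(ac_eta_phi acc) !(ac_phi_phi acc).
rewrite !(metric_expand acc) !(metric_xi acc).
rewrite (Defs.metric_sym (ac_g acc) p (Y p) (X p)).
rewrite (Defs.metric_sym (ac_g acc) p (Y p) (phi p (X p))) (metric_phiC acc).
rewrite !(Defs.metric_sym (ac_g acc) p _ 0) !(metric0l (ac_g acc)).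
have W0 : expR (w p) ^+ 2 != 0 by rewrite expf_neq0 // gt_eqF // expR_gt0.
move=> H1 H2; apply: (mulfI W0).
move: H1 H2; move: (expR (w p)) (dfun w p (X p)) (dfun w p (Y p)) => W d1 d2.
move: (dfun a p (X p)) (dfun a p (Y p)) (a p) (b p) => a1 a2 a0 b0.
move: (eta p (X p)) (eta p (Y p)) (eta p (conn_diff X Y p)) => e1 e2 e3.
move: (g p (X p) (Y p)) (g p (X p) (phi p (Y p))) => g1 g2.

by nra.
Qed.

Lemma dw_phi p x : dfun w p (phi p x) = 0.
Proof.
have := dw_eta_sym p (phi p x) (xi p).
by rewrite (ac_eta_xi acc) (ac_eta_phi acc) mulr0 mulr1.
Qed.

Section Horizontal.
Variables (p : M) (y z : T).
Hypotheses (ey : eta p y = 0) (ez : eta p z = 0).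

(* conn_diff is symmetric and, on ker eta and modulo xi, commutes with phi, hence is
   complex bilinear there; as phi is symmetric for gb, replacing x by phi x in
   conn_diff_metric then amounts to replacing z by phi z. *)
Lemma dconf_phi x : eta p x = 0 ->
  dfun a p (phi p x) * g p y z + dfun b p (phi p x) * g p y (phi p z) =
  dfun a p x * g p y (phi p z) - dfun b p x * g p y z.
Proof.
move=> ex.
have oA := cdom_open (chart_at p); have Ap := chart_at_dom p.
have [X [sX _] XE] := ext_hor ex.
have [Y [sY _] YE] := ext_hor ey.
have [Z [sZ _] ZE] := ext_hor ez.
have sPX := smooth_phi acc oA sX; have sPZ := smooth_phi acc oA sZ.
have eX : eta p (X p) = 0 by rewrite XE.
have eY : eta p (Y p) = 0 by rewrite YE.
have eZ : eta p (Z p) = 0 by rewrite ZE.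
have H1 := conn_diff_metric oA Ap sPX sY sZ.
have H2 := conn_diff_metric oA Ap sX sY sPZ.
have [c1 E1] := conn_diff_phi oA Ap sY sX (or_introl eY).
have [c2 E2] := conn_diff_phi oA Ap sZ sX (or_introl eZ).
have [c3 E3] := conn_diff_phi oA Ap sX sZ (or_introl eX).
rewrite (conn_diff_sym oA Ap sPX sY) (conn_diff_sym oA Ap sPX sZ) E1 E2 in H1.
rewrite E3 (conn_diff_sym oA Ap sX sY) (conn_diff_sym oA Ap sX sZ) in H2.
move: H1 H2; rewrite eX eZ !mulr0 !scale0r !addr0.
move: (conn_diff Y X p) (conn_diff Z X p) => d1 d2.
rewrite !(metricDl gbP, metricDr gbP, metricZl gbP, metricZr gbP).
rewrite (g_bar_sym acc u v w p (xi p)) !gb_xi eY eZ !mulr0 !addr0.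
(* The two left-hand sides now coincide, hence so do [N (phi x) y z] and [N x y (phi z)]. *)
rewrite (metric_phiC accb) => -> /=.
rewrite /nabla_g_bar XE YE ZE ex ey ez !(ac_eta_phi acc) !(ac_phi_phi acc) ez.
rewrite scale0r addr0 (metricNr (ac_g acc)) !mulr0 !addr0 !subr0 => H.
move: H; move: (dfun a p (phi p x)) (dfun b p (phi p x)) (dfun a p x) (dfun b p x) => d1' d2' d3 d4.
by move: (g p y z) (g p y (phi p z)) (a p) (b p) (expR (w p)) => *; lra.
Qed.

(** By symmetry [conn_diff xi y] is the known [conn_diff y xi], so the left-hand side of
    [conn_diff_metric] is twice $(1-e^w)$ times [gb y (phi z)]. *)
Lemma dconf_xi :
  dfun a p (xi p) * g p y z + dfun b p (xi p) * g p y (phi p z) =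
  2 * (1 - expR (w p)) * (a p * g p y (phi p z) - b p * g p y z).
Proof.
have oA := cdom_open (chart_at p); have Ap := chart_at_dom p.
have [Y [sY _] YE] := ext_hor ey.
have [Z [sZ _] ZE] := ext_hor ez.
have sxi := smooth_xi acc (cdom (chart_at p)).
have := conn_diff_metric oA Ap sxi sY sZ.
rewrite (conn_diff_sym oA Ap sxi sY) (conn_diff_sym oA Ap sxi sZ).
rewrite (conn_diff_xi oA Ap sY) (conn_diff_xi oA Ap sZ) YE ZE.
rewrite !(metricDl gbP, metricDr gbP, metricZl gbP, metricZr gbP).
rewrite (g_bar_sym acc u v w p (xi p)) !gb_xi (metric_phiC accb) !g_barE.
rewrite !(ac_eta_phi acc) !(ac_phi_phi acc) ey ez scale0r addr0 (metricNr (ac_g acc)).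
rewrite /nabla_g_bar ey ez !mulr0 !addr0 !subr0.
move: (dfun a p (xi p)) (dfun b p (xi p)) (a p) (b p) (expR (w p)) => da db a0 b0 W.
by move: (g p y z) (g p y (phi p z)) => *; lra.

Qed.

End Horizontal.

(** Testing an identity on [(y, z)] and on [(y, phi z)] for such a pair separates the coefficients
    of [g y z] and [g y (phi z)]. This is where [n > 0] enters: it makes [ker eta] nonzero. *)
Lemma hor_pair p : (0 < n)%N -> exists y z,
  [/\ eta p y = 0, eta p z = 0, g p y z = 1 & g p y (phi p z) = 0].
Proof.
move=> n0; have gP := ac_g acc.
have [y [ey y0]] : exists y, eta p y = 0 /\ y <> 0.
  apply: contrapT => noy.
  (* Were [ker eta] zero, all vectors would be multiples of [xi], contradicting the independence of
     the first two basis vectors. *)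
  have H x : x = eta p x *: xi p.
    apply/eqP; rewrite -subr_eq0; apply/eqP; apply: contrapT => x0.
    apply: noy; exists (x - eta p x *: xi p); split=> //.
    by rewrite (etaD acc) (etaN acc) (etaZ acc) (ac_eta_xi acc) mulr1 subrr.
  have n1 : (1 < (2 * n).+1)%N by rewrite ltnS muln_gt0.
  pose i0 : 'I_(2 * n).+1 := ord0; pose i1 : 'I_(2 * n).+1 := Ordinal n1.
  have e0 := H (delta_mx 0 i0); have e1 := H (delta_mx 0 i1).
  have := congr1 (fun r : T => r 0 i0) e0.
  have := congr1 (fun r : T => r 0 i1) e1.
  have := congr1 (fun r : T => r 0 i0) e1.
  rewrite !mxE !eqxx /= => /esym/eqP; rewrite mulf_eq0 => /orP[/eqP->|/eqP ->].
    by rewrite mul0r => /eqP; rewrite oner_eq0.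
  by move=> _; rewrite mulr0 => /eqP; rewrite oner_eq0.
have [z0 gz0] : exists z, g p y z <> 0.
  apply: contrapT => noz; apply: y0; apply: (metric_nondegenerate gP (p := p)) => z.
  by apply: contrapT => gz; apply: noz; exists z.
have [z1 [ez1 gz1]] : exists z, eta p z = 0 /\ g p y z != 0.
  exists (z0 - eta p z0 *: xi p); split.
    by rewrite (etaD acc) (etaN acc) (etaZ acc) (ac_eta_xi acc) mulr1 subrr.
  by rewrite !(metric_expand acc) (metric_xi acc) ey mulr0 subr0; apply/eqP.
set P := g p y z1 in gz1; pose Q := g p y (phi p z1).
have r0 : P ^+ 2 + Q ^+ 2 != 0.
  by rewrite paddr_eq0 ?sqr_ge0 // negb_and sqrf_eq0 gz1.
(* With [phi] acting as $i$, this is [z1] divided by $P - iQ$, the value at [(y, z1)] of the complex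
   bilinear form [g - i g(., phi .)]. *)
exists y, ((P / (P ^+ 2 + Q ^+ 2)) *: z1 + (Q / (P ^+ 2 + Q ^+ 2)) *: phi p z1); split=> //.
- by rewrite (etaD acc) !(etaZ acc) (ac_eta_phi acc) ez1 !mulr0 addr0.
- by rewrite !(metric_expand acc) -/P -/Q; field.
rewrite (phiD acc) !(phiZ acc) (ac_phi_phi acc) ez1 scale0r addr0.
by rewrite !(metric_expand acc) -/P -/Q; field.
Qed.

Hypothesis n_gt0 : (0 < n)%N.

Lemma dconf_phiE p x : eta p x = 0 ->
  dfun a p (phi p x) = - dfun b p x /\ dfun b p (phi p x) = dfun a p x.
Proof.
move=> ex; have [y [z [ey ez g1 g0]]] := hor_pair p n_gt0.
have := dconf_phi ey ez ex; rewrite g1 g0.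
have ez' : eta p (phi p z) = 0 by rewrite (ac_eta_phi acc).
have := dconf_phi ey ez' ex.
rewrite (ac_phi_phi acc) ez scale0r addr0 (metricNr (ac_g acc)) g1 g0.
move: (dfun a p (phi p x)) (dfun b p (phi p x)) (dfun a p x) (dfun b p x) => *.
by split; lra.
Qed.

Lemma dconf_xiE p :
  dfun a p (xi p) = - (2 * (1 - expR (w p)) * b p) /\
  dfun b p (xi p) = 2 * (1 - expR (w p)) * a p.
Proof.
have [y [z [ey ez g1 g0]]] := hor_pair p n_gt0.
have := dconf_xi ey ez; rewrite g1 g0.
have ez' : eta p (phi p z) = 0 by rewrite (ac_eta_phi acc).
have := dconf_xi ey ez'.
rewrite (ac_phi_phi acc) ez scale0r addr0 (metricNr (ac_g acc)) g1 g0.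
move: (dfun a p (xi p)) (dfun b p (xi p)) (a p) (b p) (expR (w p)) => da db a0 b0 W.
by move=> H1 H2; split; nra.
Qed.

(** Real and imaginary parts of $2|c|^2 d(u+iv) = \bar c\, dc$ for $c = a + ib = e^{2(u+iv)}$. *)
Lemma du_dv_of_dconf p x : let r := 2 * (a p ^+ 2 + b p ^+ 2) in
  r * dfun u p x = a p * dfun a p x + b p * dfun b p x /\
  r * dfun v p x = a p * dfun b p x - b p * dfun a p x.
Proof.
rewrite /= dfun_conf_re // dfun_conf_im //.
move: (a p) (b p) (dfun u p x) (dfun v p x) => *.
by split; ring.
Qed.

Let r_neq0 p : 2 * (a p ^+ 2 + b p ^+ 2) != 0.
Proof. by rewrite mulf_neq0 ?conf_neq0 // pnatr_eq0. Qed.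

Lemma duv_xi p : dfun u p (xi p) = 0 /\ dfun v p (xi p) = 1 - expR (w p).
Proof.
have [ru rv] := du_dv_of_dconf p (xi p); have [Ea Eb] := dconf_xiE p.
by split; apply: (mulfI (r_neq0 p)); rewrite ?ru ?rv Ea Eb;
   move: (a p) (b p) (expR (w p)) => *; ring.
Qed.

(** On the part [h] of [x] in [ker eta] this is the holomorphy of $a + ib$ carried over to $u + iv$;
    the part along [xi] is [duv_xi]. *)
Lemma duv_phi p x : dfun u p x - dfun v p (phi p x) = 0 /\
  dfun u p (phi p x) + dfun v p x = (1 - expR (w p)) * eta p x.
Proof.
pose h := x - eta p x *: xi p.
have eh : eta p h = 0.
  by rewrite /h (etaD acc) (etaN acc) (etaZ acc) (ac_eta_xi acc) mulr1 subrr.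
have ph : phi p h = phi p x.
  by rewrite /h (phiD acc) (phiN acc) (phiZ acc) (ac_phi_xi acc) scaler0 subr0.
have [ux vx] := duv_xi p.
have dh (f : M -> R) : dfun f p x = dfun f p h + eta p x * dfun f p (xi p).
  by rewrite -dfunZ_vec -dfunD_vec /h subrK.
rewrite !dh ux vx -ph.
have [Ea Eb] := dconf_phiE eh.
have [ru rv] := du_dv_of_dconf p h.
have [rpu rpv] := du_dv_of_dconf p (phi p h).
have E1 : dfun v p (phi p h) = dfun u p h.
  apply: (mulfI (r_neq0 p)); rewrite ru rpv Ea Eb.
  by move: (a p) (b p) (dfun a p h) (dfun b p h) => *; ring.
have E2 : dfun u p (phi p h) = - dfun v p h.
  apply: (mulfI (r_neq0 p)); rewrite rpu mulrN rv Ea Eb.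
  by move: (a p) (b p) (dfun a p h) (dfun b p h) => *; ring.
rewrite E1 E2; split; [|]; move: (dfun u p h) (dfun v p h) => *; ring.
Qed.

End Necessity.

(** * Functions on a local product *)

Lemma smooth_on_local (R : realType) (V W : normedModType R) (A : set V) (f : V -> W) :
  (forall a, A a -> exists B, B a /\ smooth_on B f) -> smooth_on A f.
Proof.
move=> H k; have {}H a : A a -> exists B, B a /\ times_differentiable k B f.
  by move=> /H[B [Ba sf]]; exists B; split => //; exact: sf.
elim: k f H => [//|k IH] f H; split=> [a /H[B [Ba [df _]]]|v]; first exact: df.
by apply: IH => a /H[B [Ba [_ Df]]]; exists B; split => //; exact: Df.
Qed.

Section LocalProduct.
Variables (R : realType) (m k : nat) (N : manifold R m) (M : manifold R k).
Variables (I : set R) (Psi : N * R -> M).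
Hypothesis I_interval : is_interval I.
Hypothesis Psi_smooth : smooth_family I Psi.

(** Chain rule in the preferred chart at [Psi (q, t)]; by continuity the curve stays in its domain
    for parameters near [t]. *)
Lemma curve_derive (f : M -> R) q t : I t -> smooth_function setT f ->
  is_derive t 1 (fun s => f (Psi (q, s)))
    (dfun f (Psi (q, t)) (velocity (fun s => Psi (q, s)) t)).
Proof.
move=> It sf; have [cP sP] := Psi_smooth.
pose p := Psi (q, t); pose c' := chart_at p; pose c := chart_at q.
have [ac' dc'] := (chart_at_atlas p, chart_at_dom p).
have [ac dc] := (chart_at_atlas q, chart_at_dom q).
have cqK : cinv c (cmap c q) = q by exact: cmapK_dom.
pose F (z : 'rV[R]_m * R^o) := cmap c' (Psi (cinv c z.1, z.2)).
have dF : differentiable F (cmap c q, t : R^o).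
  have [df _] := sP c c' ac ac' 1%N; apply: df; split=> /=; [by exists q|exact: It|].
  by rewrite cqK.
pose gam : R^o -> 'rV[R]_k := fun s => F (cmap c q, s).
have gamE : gam = cmap c' \o (fun s => Psi (q, s)).
  by apply/funext => s; rewrite /gam /F /= cqK.
have dg : differentiable gam (t : R^o).
  have [did _] := is_diff_id (t : R^o).
  have dc1 : differentiable (cst (cmap c q) : R^o -> 'rV[R]_m) (t : R^o).
    exact: differentiable_cst.
  exact: (differentiable_comp (differentiable_pair dc1 did) dF).
have df : differentiable (f \o cinv c' : _ -> R^o) (gam t).
  rewrite gamE; exact: smooth_function_differentiable ac' dc' _ sf.
have dfg := differentiable_comp dg df.
have nE : \forall s \near (t : R^o), ((f \o cinv c' : _ -> R^o) \o gam) s = f (Psi (q, s)).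
  have cs : {for t, continuous (fun s => Psi (q, s))}.
    apply: (@continuous_comp _ _ _ (fun s : R => (q, s)) Psi); last exact: cP.
    exact: (cvg_pair (G := nbhs q) (H := nbhs t) (cvg_cst q) cvg_id).
  have n1 : \forall s \near t, cdom c' (Psi (q, s)).
    exact: (cs _ (open_nbhs_nbhs (conj (cdom_open c') dc'))).
  apply: filterS n1 => s /= cs'.
  by rewrite gamE /= cmapK_dom.
have dh := near_eq_differentiable nE dfg.
apply: DeriveDef; first exact: diff_derivable.
have vE : velocity (fun s => Psi (q, s)) t = 'd gam (t : R^o) 1.
  by rewrite -(deriveE (1 : R^o) dg) -derive1E gamE.
rewrite vE (deriveE (1 : R^o) dh).
apply: (etrans (near_eq_diff nE dfg (1 : R^o))).
apply: (etrans (diff_compE (1 : R^o) dg df)).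
by rewrite gamE.
Qed.

(** Mean value theorem on the segment from [t] to [t'], contained in [I] because [I] is an
    interval. *)
Lemma curve_constant (f : M -> R) q t t' : smooth_function setT f ->
  (forall s, I s -> dfun f (Psi (q, s)) (velocity (fun s => Psi (q, s)) s) = 0) ->
  I t -> I t' -> f (Psi (q, t)) = f (Psi (q, t')).
Proof.
move=> sf f0.
wlog tt' : t t' / t <= t'.
  move=> H It It'; have [/H|/ltW/H] := leP t t'; first exact.
  by move=> /(_ It' It).
move=> It It'; have D s : I s -> is_derive s 1 (fun s => f (Psi (q, s))) 0.
  by move=> Is; rewrite -(f0 s Is); exact: curve_derive.
have Iin s : s \in `[t, t'] -> I s.
  by rewrite in_itv /= => /andP[s1 s2]; apply: (I_interval It It'); rewrite s1.
have [||s _] := @MVT_segment R (fun s => f (Psi (q, s))) (fun=> 0) t t' tt'.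
- move=> s sI; apply: D; apply: Iin; exact: subset_itv_oo_cc sI.
- apply: derivable_within_continuous => s sI.
  by have [] := D s (Iin s sI).
by rewrite mul0r => /eqP; rewrite subr_eq0 => /eqP.
Qed.

Section Slice.
Variables (t : R) (c : chart R m N) (c' : chart R k M).
Hypotheses (It : I t) (ac : atlas c) (ac' : atlas c').

Definition slice_dom : set 'rV[R]_m :=
  [set y | (cmap c @` cdom c) y /\ cdom c' (Psi (cinv c y, t))].

Lemma slice_open : open slice_dom.
Proof.
have [cP _] := Psi_smooth.
rewrite openE => y [cy c'y].
have n1 : \forall z \near y, (cmap c @` cdom c) z.
  by apply: open_nbhs_nbhs; split => //; exact: cimg_open.
have cs : {for y, continuous (fun z => Psi (cinv c z, t))}.
  apply: (@continuous_comp _ _ _ (fun z => (cinv c z, t)) Psi); last exact: cP.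
  have cc : cinv c z @[z --> y] --> cinv c y := cinv_continuous (c := c) (mem_set cy).
  exact: (cvg_pair (G := nbhs (cinv c y)) (H := nbhs t) cc (cvg_cst t)).
have n2 := cs _ (open_nbhs_nbhs (conj (cdom_open c') c'y)).
by apply: filterS2 n1 n2.
Qed.

Lemma slice_smooth : smooth_on slice_dom (fun y => cmap c' (Psi (cinv c y, t))).
Proof.
have [_ sP] := Psi_smooth.
apply: (smooth_on_slice (t := t)) (sP c c' ac ac') => y [cy c'y]; by split.
Qed.

Lemma slice_function (f : M -> R) : smooth_function setT f ->
  smooth_on slice_dom ((f \o cinv c' : _ -> R^o) \o (fun y => cmap c' (Psi (cinv c y, t)))).
Proof.
move=> sf.
have o2 : open (cmap c' @` (setT `&` cdom c')) := chart_image_open openT.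
apply: (smooth_on_comp_rV slice_open o2 _ slice_smooth (sf c' ac')).
by move=> y [cy c'y]; exists (Psi (cinv c y, t)).
Qed.

Lemma slice_eq (f : M -> R) y : slice_dom y ->
  ((f \o cinv c' : _ -> R^o) \o (fun y => cmap c' (Psi (cinv c y, t)))) y =
  ((fun q => f (Psi (q, t))) \o cinv c) y.
Proof. by move=> [cy c'y] /=; rewrite cmapK_dom. Qed.

End Slice.

(** The chart of [M] used to express the slice depends on the point, whence the appeal to
    [smooth_on_local]. *)
Lemma smooth_slice (f : M -> R) t : I t -> smooth_function setT f ->
  smooth_function setT (fun q => f (Psi (q, t))).
Proof.
move=> It sf c ac; apply: smooth_on_local => _ [q [_ cq] <-].
have ac' := chart_at_atlas (Psi (q, t)).
exists (slice_dom t c (chart_at (Psi (q, t)))); split.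
  by split; [exists q|rewrite cmapK_dom //; exact: chart_at_dom].
have oB : open (slice_dom t c (chart_at (Psi (q, t)))) by exact: slice_open.
apply: (smooth_on_eq oB _ (slice_function It ac ac' sf)) => y.
exact: slice_eq.
Qed.

Lemma dfun_slice (f : M -> R) t q x : I t -> smooth_function setT f ->
  dfun (fun q => f (Psi (q, t))) q x =
  dfun f (Psi (q, t)) (mdiff (fun q => Psi (q, t)) q x).
Proof.
move=> It sf.
have [ac dc] := (chart_at_atlas q, chart_at_dom q).
pose p := Psi (q, t); have [ac' dc'] := (chart_at_atlas p, chart_at_dom p).
have cqK : cinv (chart_at q) (Defs.coord0 q) = q by exact: cmapK_dom.
pose B := slice_dom t (chart_at q) (chart_at p).
have Bq : B (Defs.coord0 q) by split; [exists q|rewrite cqK].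
have oB : open B by exact: slice_open.
have ds := smooth_on_differentiable (slice_smooth It ac ac') Bq.
have df : differentiable (f \o cinv (chart_at p) : _ -> R^o)
    (cmap (chart_at p) (Psi (cinv (chart_at q) (Defs.coord0 q), t))).
  by rewrite cqK; exact: smooth_function_differentiable ac' dc' _ sf.
have dfs := differentiable_comp ds df.
have nE : \forall y \near Defs.coord0 q,
    ((f \o cinv (chart_at p) : _ -> R^o) \o
      (fun y => cmap (chart_at p) (Psi (cinv (chart_at q) y, t)))) y =
    ((fun q => f (Psi (q, t))) \o cinv (chart_at q)) y.
  by apply: (open_near oB Bq) => y; exact: slice_eq.
apply: (etrans (near_eq_diff nE dfs x)).
by apply: (etrans (diff_compE x ds df)); rewrite cqK.
Qed.

End LocalProduct.

(** * Assembly of the equivalence and of the case w = 0 *)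

Theorem proposition5p1 (R : realType) (n : nat) (n_gt0 : (0 < n)%N)
    (M : manifold R (2 * n).+1)
    (phi : M -> 'rV[R]_(2 * n).+1 -> 'rV[R]_(2 * n).+1)
    (xi : M -> 'rV[R]_(2 * n).+1)
    (eta : M -> 'rV[R]_(2 * n).+1 -> R)
    (g : M -> 'rV[R]_(2 * n).+1 -> 'rV[R]_(2 * n).+1 -> R)
    (u v w : M -> R)
    (sasaki_M : sasaki_like phi xi eta g)
    (u_smooth : smooth_function setT u)
    (v_smooth : smooth_function setT v)
    (w_smooth : smooth_function setT w) :
  let sasaki_bar :=
    sasaki_like phi (xi_bar w xi) (eta_bar w eta) (g_bar u v w phi eta g) in
  (sasaki_bar <->
     (forall p x, dfun w p (phi p x) = 0) /\
     (forall p x, dfun u p x - dfun v p (phi p x) = 0) /\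
     (forall p x,
        dfun u p (phi p x) + dfun v p x = (1 - expR (w p)) * eta p x)) /\
  (sasaki_bar ->
     (forall p, dfun u p (xi p) = 0 /\ dfun v p (xi p) = 1 - expR (w p)) /\
     ((forall p, w p = 0) ->
        (forall p, dfun u p (xi p) = 0 /\ dfun v p (xi p) = 0) /\
        (forall (N : manifold R (2 * n)) (I : set R) (Psi : N * R -> M),
           local_product xi eta I Psi ->
           exists uN vN : N -> R,
             (forall q t, I t -> u (Psi (q, t)) = uN q /\
                                 v (Psi (q, t)) = vN q) /\
             (forall t (J : N -> 'rV[R]_(2 * n) -> 'rV[R]_(2 * n)), I t ->
                restricts_to phi (fun q => Psi (q, t)) J ->
                holomorphic J (fun q => Complex (uN q) (vN q)))))).
Proof.
have [acc [nabla lc /(sasaki_condition_formula acc lc) nabla_sasaki]] := sasaki_M.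
move=> sasaki_bar.
have necessity : sasaki_bar -> (forall p x, dfun w p (phi p x) = 0) /\
    (forall p, dfun u p (xi p) = 0 /\ dfun v p (xi p) = 1 - expR (w p)) /\
    (forall p x, dfun u p x - dfun v p (phi p x) = 0 /\
       dfun u p (phi p x) + dfun v p x = (1 - expR (w p)) * eta p x).
  move=> [accb [nablab lcb /(sasaki_condition_formula accb lcb) nablab_sasaki]].
  split; [move=> p x|split=> [p|p x]].
  - exact: (dw_phi acc u_smooth v_smooth w_smooth lc nabla_sasaki lcb nablab_sasaki).
  - exact: (duv_xi acc u_smooth v_smooth w_smooth lc nabla_sasaki lcb nablab_sasaki n_gt0).
  - exact: (duv_phi acc u_smooth v_smooth w_smooth lc nabla_sasaki lcb nablab_sasaki n_gt0).
split.
  split=> [/necessity[Hw [_ Huv]]|[dw0 [du dv]]].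
    by split=> //; split=> p x; have [] := Huv p x.
  have dv_phi p x : dfun v p (phi p x) = dfun u p x.
    by have := du p x => /eqP; rewrite subr_eq0 => /eqP.
  have du_phi p x : dfun u p (phi p x) = (1 - expR (w p)) * eta p x - dfun v p x.
    by rewrite -dv addrK.
  have [U U_smooth UE] := gradient (ac_g acc) u_smooth.
  have accb := g_bar_almost_contact acc u_smooth v_smooth w_smooth.
  split=> //; exists (nabla_bar phi xi eta g u v w nabla U).
    split.
    - exact: nabla_bar_connection.
    - exact: nabla_bar_torsion_free.
    - exact: nabla_bar_metric.
  apply: (sasaki_formula_condition accb).
  exact: nabla_bar_sasaki.
move=> /necessity[_ [Hxi Huv]]; split=> // w0.
have E0 p : 1 - expR (w p) = 0 :> R by rewrite w0 expR0 subrr.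
have Hxi0 p : dfun u p (xi p) = 0 /\ dfun v p (xi p) = 0.
  by have [-> ->] := Hxi p; rewrite E0.
split=> // N I Psi lp.
have [t0 It0] := lp_nonempty lp.
have vel f q t : (forall p, dfun f p (xi p) = 0) -> I t ->
    dfun f (Psi (q, t)) (velocity (fun s => Psi (q, s)) t) = 0.
  move=> f0 It; have [c ->] := lp_vertical lp q It.
  by rewrite dfunZ_vec f0 mulr0.
have const f q t t' : smooth_function setT f -> (forall p, dfun f p (xi p) = 0) ->
    I t -> I t' -> f (Psi (q, t)) = f (Psi (q, t')).
  move=> sf f0 It It'.
  by apply: (curve_constant (lp_interval lp) (lp_smooth lp)) => // s Is; exact: vel.
have uxi p : dfun u p (xi p) = 0 by case: (Hxi0 p).
have vxi p : dfun v p (xi p) = 0 by case: (Hxi0 p).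
exists (fun q => u (Psi (q, t0))), (fun q => v (Psi (q, t0))); split=> [q t It|t J It HJ].
  by split; exact: const.
split=> /=; [exact: (smooth_slice (lp_smooth lp))|exact: (smooth_slice (lp_smooth lp))|].
move=> q y; rewrite /cdfun /=.
(* [uN] and [vN] are read off at [t0], while [J] is induced on the slice at [t]; constancy along the
   curves identifies the restrictions to both slices. *)
have uE : (fun q => u (Psi (q, t0))) = (fun q => u (Psi (q, t))).
  by apply/funext => r; exact: const.
have vE : (fun q => v (Psi (q, t0))) = (fun q => v (Psi (q, t))).
  by apply/funext => r; exact: const.
rewrite uE vE !(dfun_slice (lp_smooth lp)) // HJ.
(* As [HJ] has turned [J] into [phi], these equations with [w = 0] are the Cauchy-Riemann equations
   on the slice. *)
have [d1 d2] := Huv (Psi (q, t)) (mdiff (fun q => Psi (q, t)) q y).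
move: d1 d2; rewrite E0 mul0r.
move: (dfun u _ _) (dfun v _ _) (dfun u _ _) (dfun v _ _) => a b c d d1 d2.
by apply/eqP; rewrite eq_complex /=; apply/andP; split; apply/eqP; lra.
Qed.
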